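(* Let $n\geq 3$ and let $\mathcal{G}$ be a germ of holomorphic foliation of codimension one at $(\mathbb{C}^n,0)$. Then there is a germ of one-dimensional holomorphic foliation $\mathcal{F}$ at $(\mathbb{C}^n,0)$, with $\mathrm{cod}(\mathrm{Sing}(\mathcal{F}))=2$, such that $(\mathcal{F},\mathcal{G})$ is a germ of $2$-flag of holomorphic foliations at $(\mathbb{C}^n,0)$ and $\mathrm{Sing}(\mathcal{G})\subseteq\mathrm{Sing}(\mathcal{F})$.
   Context: Foliations are singular holomorphic foliations and are reduced: every irreducible component of the singular set has codimension $\geq 2$. A germ of one-dimensional holomorphic foliation at $(\mathbb{C}^n,0)$ is determined by a germ of holomorphic vector field $X$, with singular set the zero set of $X$; a germ of codimension-one holomorphic foliation is determined by a germ of holomorphic $1$-form $\omega$ with $\omega\wedge d\omega\equiv 0$, with singular set the zero set of $\omega$. If $\mathcal{F}$ is determined by $X$ and $\mathcal{G}$ by $\omega$, the pair $(\mathcal{F},\mathcal{G})$ is a germ of $2$-flag of holomorphic foliations at $(\mathbb{C}^n,0)$ if $\omega(X)\equiv 0$. *)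

(* Defs.v *)
From HB Require Import structures.
From mathcomp Require Export all_boot all_order all_algebra.
From mathcomp Require Export all_classical all_reals all_analysis.
From mathcomp Require Export complex.

Set Implicit Arguments.
Unset Strict Implicit.
Unset Printing Implicit Defensive.

Export Order.TTheory GRing.Theory Num.Theory numFieldNormedType.Exports.

Local Open Scope classical_set_scope.
Local Open Scope ring_scope.

(* The field of complex numbers R[i], packed as a numClosedFieldType: the
   topology and the normed module structure of C and C^n are inferred from this
   structure. *)
Definition Cplx (R : realType) : numClosedFieldType := R[i].

(* [differentiable] is over the scalar field C: complex differentiability. *)
Definition holomorphic_on (R : realType) (n m : nat)
    (U : set 'rV[Cplx R]_n) (f : 'rV[Cplx R]_n -> 'rV[Cplx R]_m) : Prop :=
  forall x, U x -> differentiable f x.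

(* A is, near its point p, a complex submanifold of dimension d: some
   biholomorphism phi : V -> W (with inverse psi) from a neighbourhood of p
   satisfies A `&` V = phi^-1 (C^d x {0}). *)
Definition regular_point (R : realType) (n : nat)
    (A : set 'rV[Cplx R]_n) (d : nat) (p : 'rV[Cplx R]_n) : Prop :=
  [/\ A p, (d <= n)%N &
  exists (V W : set 'rV[Cplx R]_n) (phi psi : 'rV[Cplx R]_n -> 'rV[Cplx R]_n),
    [/\ [/\ open V, V p & open W],
        [/\ holomorphic_on V phi, holomorphic_on W psi,
            (forall x, V x -> W (phi x)) & (forall y, W y -> V (psi y))],
        (forall x, V x -> psi (phi x) = x),
        (forall y, W y -> phi (psi y) = y) &
        (forall x, V x ->
           (A x <-> forall i : 'I_n, (d <= i)%N -> phi x 0 i = 0))]].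

Definition regular_locus (R : realType) (n : nat) (A : set 'rV[Cplx R]_n) :
    set 'rV[Cplx R]_n :=
  [set p | exists d, regular_point A d p].

(* The irreducible components of an analytic subset A of the open set U are
   the closures in U of the connected components of its regular locus. *)
Definition irreducible_component (R : realType) (n : nat)
    (U A Y : set 'rV[Cplx R]_n) : Prop :=
  exists2 p, regular_locus A p &
    Y = closure (connected_component (regular_locus A) p) `&` U.

(* The dimension of an analytic set is the largest dimension of a regular
   point; its dimension at p is the limsup of the dimensions of the regular
   points tending to p.  Neither is defined (for any c) when there are no such
   points, i.e. for the empty set, resp. the empty germ. *)
Definition has_codim (R : realType) (n : nat)
    (A : set 'rV[Cplx R]_n) (c : nat) : Prop :=
  exists d, [/\ (d + c)%N = n,
    (exists q, regular_point A d q) &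
    (forall q e, regular_point A e q -> (e <= d)%N)].

Definition has_codim_at (R : realType) (n : nat)
    (A : set 'rV[Cplx R]_n) (p : 'rV[Cplx R]_n) (c : nat) : Prop :=
  exists d, [/\ (d + c)%N = n,
    closure [set q | regular_point A d q] p &
    \forall q \near p, forall e, regular_point A e q -> (e <= d)%N].

(* Vector fields X = \sum_i X_i d/dx_i and 1-forms w = \sum_i w_i dx_i are
   both given by their row of coefficients. *)
Definition sing (R : realType) (n : nat)
    (f : 'rV[Cplx R]_n -> 'rV[Cplx R]_n) : set 'rV[Cplx R]_n :=
  [set x | f x = 0].

Definition pairing (R : realType) (n : nat) (a v : 'rV[Cplx R]_n) : Cplx R :=
  \sum_(i < n) a 0 i * v 0 i.

(* (dw)_x (u, v) = u(w(v)) - v(w(u)) for constant vector fields u and v. *)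
Definition dform (R : realType) (n : nat) (w : 'rV[Cplx R]_n -> 'rV[Cplx R]_n)
    (x u v : 'rV[Cplx R]_n) : Cplx R :=
  pairing ('D_u w x) v - pairing ('D_v w x) u.

(* (w /\ dw)_x (t, u, v) *)
Definition wedge_dform (R : realType) (n : nat)
    (w : 'rV[Cplx R]_n -> 'rV[Cplx R]_n) (x t u v : 'rV[Cplx R]_n) : Cplx R :=
  pairing (w x) t * dform w x u v
  + pairing (w x) u * dform w x v t
  + pairing (w x) v * dform w x t u.

Definition reduced_on (R : realType) (n : nat) (U : set 'rV[Cplx R]_n)
    (f : 'rV[Cplx R]_n -> 'rV[Cplx R]_n) : Prop :=
  forall Y, irreducible_component U (sing f `&` U) Y ->
    exists2 c, has_codim Y c & (2 <= c)%N.

(* A germ at 0 is given by a representative on some neighbourhood U of 0; only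
   the values of the coefficient function on U matter. *)
Definition dim1_foliation (R : realType) (n : nat)
    (X : 'rV[Cplx R]_n -> 'rV[Cplx R]_n) : Prop :=
  exists U : set 'rV[Cplx R]_n,
    [/\ open U, U 0, holomorphic_on U X & reduced_on U X].

Definition codim1_foliation (R : realType) (n : nat)
    (w : 'rV[Cplx R]_n -> 'rV[Cplx R]_n) : Prop :=
  exists U : set 'rV[Cplx R]_n,
    [/\ open U, U 0, holomorphic_on U w,
        (forall x, U x -> forall t u v, wedge_dform w x t u v = 0) &
        reduced_on U w].

Definition flag2 (R : realType) (n : nat)
    (X w : 'rV[Cplx R]_n -> 'rV[Cplx R]_n) : Prop :=
  [/\ dim1_foliation X, codim1_foliation w &
      \forall x \near (0 : 'rV[Cplx R]_n), pairing (w x) (X x) = 0].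

(* Main.v *)
Require Import Defs.
From mathcomp Require Import ring lra.

(** The vector field is written down explicitly; the work is to choose its
    parameters and to see what its zeros are.  For constant vectors a, b, d put
    f = w(a), g = w(b), h = w(d), let l1, l2 be independent linear forms, let r
    be a nonzero constant, and take

      X = f (l1 b + r l2 d) - (l1 g + r l2 h) a.

    Then w(X) = 0 identically and X vanishes where w does.  When a, b, d are
    independent the zeros of X are the plane L = {l1 = l2 = 0} together with
    the set {f = 0, l1 g + r l2 h = 0}.  So X vanishes on a plane of codimension
    two, and near a point of L where f is nonzero it vanishes nowhere else.
    Choosing L through a line on which f does not vanish identically gives such
    points arbitrarily close to the origin: no dimension theorem for analytic
    sets is involved.  It remains to choose a, b, d so that {X = 0} contains no
    piece of hypersurface; this also makes X reduced.

    Pieces of hypersurface are handled through sheets: nonempty level sets of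
    the last coordinate of a holomorphic chart.  The form w is reduced exactly
    when no sheet lies in its zero set ([reduced_no_sheet],
    [no_sheet_reduced]).  The vectors a, b, d are taken on the moment curve
    (1, t, t^2, ...) with real t, where a nonzero vector is orthogonal to only
    finitely many points.  The key fact is [sheet_zeros]: if f vanishes on a
    sheet but on no open set meeting it, then near some point of the sheet the
    zero set of f is the sheet itself.  Hence every bad sheet in {f = 0} contains
    a nonempty piece of {f = 0} cut out by a ball with rational centre and
    radius, and one such ball excludes only finitely many parameters; as there
    are countably many balls, almost every real t is good
    ([generic_no_open_zero], [generic_sheet]).

    The fact [sheet_zeros] is the isolation of zeros of a holomorphic function
    of one variable, uniformly in the other variables.  It is derived from
    Goursat's lemma for rectangles ([goursat], [goursat_punctured]), which gives
    the Taylor expansion with integral remainder on a square ([cauchy_square],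
    [taylor_remS]); the remainder is continuous in the parameters
    ([rectint_continuous]), and the first coefficient that is not identically
    zero along the sheet controls the zeros ([slice_zeros]). *)

Set Implicit Arguments.
Unset Strict Implicit.
Unset Printing Implicit Defensive.

Local Open Scope classical_set_scope.
Local Open Scope ring_scope.

(** * Real estimates for complex numbers *)

Section ComplexPlane.
Variable R : realType.
Local Notation C := (Cplx R).
Local Notation Re := (@complex.Re R).
Local Notation Im := (@complex.Im R).
Implicit Types (z : C) (x y : R).

Lemma normC_Re z : `|Re z|%:C%C <= `|z|.
Proof. exact: normc_ge_Re. Qed.

Lemma normC_Im z : `|Im z|%:C%C <= `|z|.
Proof.
by rewrite normc_def lecR -sqrtr_sqr ler_wsqrtr // lerDr sqr_ge0.
Qed.

Lemma normC_le_ReIm z : `|z| <= (`|Re z| + `|Im z|)%:C%C.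
Proof.
rewrite normc_def lecR -[leRHS]ger0_norm ?addr_ge0// -sqrtr_sqr ler_wsqrtr //.
rewrite sqrrD !real_normK ?num_real// addrAC lerDl.
by rewrite mulrn_wge0 // mulr_ge0.
Qed.

Lemma normCR x : `|x%:C%C : C| = `|x|%:C%C.
Proof. by rewrite normc_def /= expr0n addr0 sqrtr_sqr. Qed.

Lemma normC_real z : `|z| = (Re `|z|)%:C%C.
Proof. by rewrite normc_def. Qed.

Lemma realC_ge0 (m : R) : ((0 : C) <= m%:C%C) = (0 <= m).
Proof. by rewrite -lecR. Qed.

Lemma realC_gt0 (m : R) : ((0 : C) < m%:C%C) = (0 < m).
Proof. by rewrite -ltcR. Qed.

Lemma norm_inv_le (a : R) (w : C) : 0 < a -> a%:C%C <= `|w| -> `|w^-1| <= (a^-1)%:C%C.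
Proof.
move=> a0 h; have aC : (0 : C) < a%:C%C by rewrite realC_gt0.
rewrite normfV (_ : (a^-1)%:C%C = (a%:C%C)^-1 :> C); last by rewrite (fmorphV (real_complex R)).
by rewrite lef_pV2 // posrE (lt_le_trans aC h).
Qed.

Lemma nonneg_realC (c : C) : 0 <= c -> exists2 m : R, 0 <= m & c = m%:C%C.
Proof.
case: c => x y; rewrite lecE /= => /andP[/eqP e h].
by exists x => //; rewrite e.
Qed.

Lemma posC_real (e : C) : 0 < e -> e = (Re e)%:C%C /\ 0 < Re e.
Proof.
case: e => a b; rewrite ltcE /= => /andP[/eqP -> ha]; split => //.
Qed.

(** The radii of balls in a complex normed space are complex numbers; this and
    [cvg_realdist] trade them for real ones, on which the order is total. *)
Lemma nbhs_realdist (V : normedModType C) (x : V) (P : set V) :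
  nbhs x P <-> exists2 e : R, 0 < e & forall t, `|t - x| < e%:C%C -> P t.
Proof.
split=> [/nbhs_ballP[e /= /posC_real[-> e0] h]|[e e0 h]].
  by exists (Re e) => // t ht; apply: h; rewrite -ball_normE /= distrC.
apply/nbhs_ballP; exists e%:C%C; first by rewrite /= ltcR.
by move=> t; rewrite -ball_normE /= distrC => /h.
Qed.

Lemma cvg_realdist (V : normedModType C) (T : Type) (F : set_system T)
    (FF : Filter F) (f : T -> V) (l : V) :
  f @ F --> l <-> forall e : R, 0 < e -> \forall t \near F, `|f t - l| < e%:C%C.
Proof.
split=> [h e e0|h].
  have e0' : 0 < (e%:C%C : C) by rewrite ltcR.
  have := proj1 (@cvgrPdist_lt C V _ F FF f l) h _ e0'.
  by apply: filterS => t; rewrite distrC.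
apply/cvgrPdist_lt => e /posC_real[-> e0].
by move: (h _ e0); apply: filterS => t; rewrite distrC.
Qed.

Lemma continuous_Re : continuous (Re : C -> R).
Proof.
move=> z; apply/(@cvgrPdist_lt R R _ _ (nbhs_filter z)) => e e0.
apply/(nbhs_realdist (z : C^o)); exists e => // t; rewrite distrC => h.
by rewrite -ltcR -(raddfB (@complex.Re R)); apply: le_lt_trans (normC_Re _) h.
Qed.

Lemma continuous_Im : continuous (Im : C -> R).
Proof.
move=> z; apply/(@cvgrPdist_lt R R _ _ (nbhs_filter z)) => e e0.
apply/(nbhs_realdist (z : C^o)); exists e => // t; rewrite distrC => h.
by rewrite -ltcR -(raddfB (@complex.Im R)); apply: le_lt_trans (normC_Im _) h.
Qed.

Lemma continuous_real_complex : continuous (fun x : R => x%:C%C : C).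
Proof.
move=> x; apply/(@cvg_realdist C^o _ _ (nbhs_filter x)) => e e0.
apply/nbhs_normP; exists e => //= t /= h.
by rewrite -(rmorphB (real_complex R)) normCR ltcR distrC.
Qed.

Lemma plane_pointE x y : (x +i* y)%C = x%:C%C + 'i%C * y%:C%C :> C.
Proof. by simpc. Qed.

Lemma continuous_hline c : continuous (fun x : R => (x +i* c)%C : C).
Proof.
move=> x; rewrite (_ : (fun _ => _) = fun x => x%:C%C + 'i%C * c%:C%C); last first.
  by apply/funext => t; exact: plane_pointE.
by apply: cvgD; [exact: continuous_real_complex|exact: cvg_cst].
Qed.

Lemma continuous_vline c : continuous (fun y : R => (c +i* y)%C : C).
Proof.
move=> x; rewrite (_ : (fun _ => _) = fun x => c%:C%C + 'i%C * x%:C%C); last first.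
  by apply/funext => t; exact: plane_pointE.
by apply: cvgD; [exact: cvg_cst| apply: cvgM; [exact: cvg_cst|exact: continuous_real_complex]].
Qed.

Lemma continuous_pair (S T U : topologicalType) (f : S -> T) (g : S -> U) (x : S) :
  {for x, continuous f} -> {for x, continuous g} ->
  {for x, continuous (fun s => (f s, g s))}.
Proof.
move=> hf hg. 
apply: (@cvg_pair S T U (nbhs x) (nbhs (f x)) (nbhs (g x)) (nbhs_filter x) (nbhs_filter _) (nbhs_filter _) f g hf hg).
Qed.

Section CplxContinuity.
Variables (T : topologicalType) (t0 : T) (f g : T -> C).
Hypotheses (hf : {for t0, continuous f}) (hg : {for t0, continuous g}).

Lemma continuousB_C : {for t0, continuous (fun t => f t - g t)}.
Proof. exact: (@continuousB _ C^o T f g t0 hf hg). Qed.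

Lemma continuousD_C : {for t0, continuous (fun t => f t + g t)}.
Proof. exact: (@continuousD _ C^o T f g t0 hf hg). Qed.

Lemma continuousM_C : {for t0, continuous (fun t => f t * g t)}.
Proof. exact: (@continuousM C T f g t0 hf hg). Qed.

Lemma continuousV_C : f t0 != 0 -> {for t0, continuous (fun t => (f t)^-1)}.
Proof. by move=> f0; exact: (@continuousV _ T f t0 f0 hf). Qed.

Lemma continuousX_C k : {for t0, continuous (fun t => f t ^+ k)}.
Proof.
elim: k => [|k IH]; first by rewrite /= /continuous_at; exact: cvg_cst.
rewrite (_ : (fun _ => _) = (fun t => f t * f t ^+ k)); last first.
  by apply/funext => t; rewrite exprS.
exact: (@continuousM C T f _ t0 hf IH).
Qed.

End CplxContinuity.

End ComplexPlane.

(** * Integrals of complex functions on segments *)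

Section SegmentIntegral.
Variable R : realType.
Local Notation C := (Cplx R).
Local Notation Re := (@complex.Re R).
Local Notation Im := (@complex.Im R).

(** Continuity at every point of the segment as a function on the whole line,
    which is stronger than continuity of the restriction: the integrands below are
    restrictions of functions continuous on open sets. *)
Definition cont_on (a b : R) (g : R -> C) :=
  forall t, a <= t <= b -> {for t, continuous g}.

Local Notation mu := (@lebesgue_measure R).

Definition rint (a b : R) (g : R -> R) : R := (\int[mu]_(t in `[a, b]) g t)%R.

Definition cint (a b : R) (g : R -> C) : C :=
  (rint a b (Re \o g) +i* rint a b (Im \o g))%C.

Definition rcont_on (a b : R) (g : R -> R) :=
  forall t, a <= t <= b -> {for t, continuous g}.

Lemma rcont_integrable a b g : rcont_on a b g ->
  mu.-integrable `[a, b] (EFin \o g).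
Proof.
move=> h; apply: continuous_compact_integrable; first exact: segment_compact.
apply: continuous_in_subspaceT => t; rewrite inE /= in_itv /= => ht.
exact: h.
Qed.

Lemma rintD a b f g : rcont_on a b f -> rcont_on a b g ->
  rint a b (fun t => f t + g t) = rint a b f + rint a b g.
Proof. by move=> hf hg; rewrite /rint RintegralD//; exact: rcont_integrable. Qed.

Lemma rintZ a b k f : rcont_on a b f -> rint a b (fun t => k * f t) = k * rint a b f.
Proof. by move=> hf; rewrite /rint RintegralZl//; exact: rcont_integrable. Qed.

Lemma rint_cst a b k : a <= b -> rint a b (fun=> k) = k * (b - a).
Proof.
move=> ab; rewrite /rint Rintegral_cst//.
have /= -> := @lebesgue_measure_itv R `[a, b]; rewrite lte_fin.
by case: ltgtP ab => // -> _ /=; rewrite subrr.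
Qed.

Lemma rint_split a m b f : a <= m -> m <= b -> rcont_on a b f ->
  rint a b f = rint a m f + rint m b f.
Proof.
move=> am mb hf; have := @Rintegral_itvB R f (BLeft a) (BRight b) m
  (rcont_integrable hf).
rewrite !bnd_simp => /(_ am mb) h; rewrite /rint.
rewrite -[in LHS](subrK (\int[mu]_(t in `[a, m]) f t) (\int[mu]_(t in `[a, b]) f t)) h.
rewrite addrC; congr (_ + _); apply: Rintegral_itv_obnd_cbnd.
apply: integrableS (rcont_integrable hf) => //.
by move=> t /=; rewrite !in_itv /= => /andP[/ltW mt ->]; rewrite (le_trans am mt).
Qed.

Lemma rint_bound a b f M : a <= b -> rcont_on a b f ->
  (forall t, a <= t <= b -> `|f t| <= M) -> `|rint a b f| <= M * (b - a).
Proof.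
move=> ab hf hM; rewrite ler_norml -mulNr -!rint_cst//; apply/andP; split.
  apply: le_Rintegral => //; try exact: rcont_integrable.
  - by apply: rcont_integrable => t _; exact: cvg_cst.
  - by move=> t /=; rewrite in_itv /= => /hM; rewrite ler_norml => /andP[].
apply: le_Rintegral => //; try exact: rcont_integrable.
- by apply: rcont_integrable => t _; exact: cvg_cst.
- by move=> t /=; rewrite in_itv /= => /hM; rewrite ler_norml => /andP[].
Qed.

Lemma cont_Re a b g : cont_on a b g -> rcont_on a b (Re \o g).
Proof.
by move=> h t /h ht; apply: continuous_comp; [exact: ht|exact: continuous_Re].
Qed.

Lemma cont_Im a b g : cont_on a b g -> rcont_on a b (Im \o g).
Proof.
by move=> h t /h ht; apply: continuous_comp; [exact: ht|exact: continuous_Im].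
Qed.

Lemma cintD a b f g : cont_on a b f -> cont_on a b g ->
  cint a b (fun t => f t + g t) = cint a b f + cint a b g.
Proof.
move=> hf hg; rewrite /cint.
rewrite (_ : Re \o (fun t => f t + g t) = (fun t => (Re \o f) t + (Re \o g) t)); last first.
  by apply/funext => t /=; case: (f t) (g t) => ? ? [].
rewrite (_ : Im \o (fun t => f t + g t) = (fun t => (Im \o f) t + (Im \o g) t)); last first.
  by apply/funext => t /=; case: (f t) (g t) => ? ? [].
by rewrite !rintD//; try exact: cont_Re; exact: cont_Im.
Qed.

Lemma cintZ a b k f : cont_on a b f -> cint a b (fun t => k * f t) = k * cint a b f.
Proof.
move=> hf; rewrite /cint; case: k => u v.
have hR := cont_Re hf; have hI := cont_Im hf.
have sc k g : rcont_on a b g -> rcont_on a b (fun t => k * g t).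
  by move=> hg t /hg ht; apply: cvgM; [exact: cvg_cst|exact: ht].
have eqR : Re \o (fun t => (u +i* v)%C * f t) =
    (fun t => u * (Re \o f) t + (- v) * (Im \o f) t).
  by apply/funext => t /=; case: (f t) => ? ? /=; rewrite mulNr.
have eqI : Im \o (fun t => (u +i* v)%C * f t) =
    (fun t => u * (Im \o f) t + v * (Re \o f) t).
  by apply/funext => t /=; case: (f t) => ? ? /=.
rewrite {}eqR {}eqI.
rewrite !rintD ?rintZ//; try exact: sc.
by rewrite mulNr; simpc.
Qed.

Lemma cintN a b f : cont_on a b f -> cint a b (fun t => - f t) = - cint a b f.
Proof.
move=> hf; rewrite -mulN1r -cintZ//; congr cint.
by apply/funext => t; rewrite mulN1r.
Qed.

Lemma cont_onN a b f : cont_on a b f -> cont_on a b (fun t => - f t).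
Proof. by move=> hf t /hf ht; apply: cvgN; exact: ht. Qed.

Lemma cintB a b f g : cont_on a b f -> cont_on a b g ->
  cint a b (fun t => f t - g t) = cint a b f - cint a b g.
Proof.
move=> hf hg; have hN := cont_onN hg.
by rewrite -(cintN hg); exact: (cintD hf hN).
Qed.

Lemma cint_cst a b k : a <= b -> cint a b (fun=> k) = k * (b - a)%:C%C.
Proof.
by move=> ab; case: k => u v; rewrite /cint /comp /= !rint_cst//; simpc.
Qed.

Lemma cint_split a m b f : a <= m -> m <= b -> cont_on a b f ->
  cint a b f = cint a m f + cint m b f.
Proof.
by move=> am mb hf; rewrite /cint (rint_split am mb (cont_Re hf))
  (rint_split am mb (cont_Im hf)).
Qed.

(** The factor 2 comes from bounding the real and imaginary parts separately. *)
Lemma cint_bound a b f M : a <= b -> cont_on a b f ->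
  (forall t, a <= t <= b -> `|f t| <= M%:C%C) ->
  `|cint a b f| <= (M * (b - a) *+ 2)%:C%C.
Proof.
move=> ab hf hM; apply: le_trans (normC_le_ReIm _) _; rewrite lecR mulr2n /=.
apply: lerD; apply: rint_bound => //; try exact: cont_Re; try exact: cont_Im.
  by move=> t /hM h; rewrite -lecR; apply: le_trans h; exact: normC_Re.
by move=> t /hM h; rewrite -lecR; apply: le_trans h; exact: normC_Im.
Qed.

Lemma eq_cint a b f g : (forall t, a <= t <= b -> f t = g t) ->
  cint a b f = cint a b g.
Proof.
move=> h; rewrite /cint; congr (_ +i* _)%C; apply: eq_Rintegral => t;
by rewrite inE /= in_itv /= => /h ->.
Qed.

End SegmentIntegral.

(** * Goursat's lemma on rectangles *)

Section Goursat.
Variable R : realType.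
Local Notation C := (Cplx R).
Local Notation Re := (@complex.Re R).
Local Notation Im := (@complex.Im R).

(** The first-order expansion in the form needed to compare a function with an
    affine one on small rectangles. *)
Lemma differentiable_slope (V W : normedModType C) (f : V -> W) (x : V) :
  differentiable f x -> forall e : R, 0 < e -> exists2 d : R, 0 < d &
    forall t, `|t - x| < d%:C%C -> `|f t - f x - 'd f x (t - x)| <= e%:C%C * `|t - x|.
Proof.
move=> df e e0; have e0' : 0 < (e%:C%C : C) by rewrite ltcR.
have [_ h] := proj1 (diff_locallyP x f) df.
have h' : (f \o shift x) - (cst (f x) + 'd f x) =o_ (0 : V) id.
  by rewrite {1}h addrC addKr.
have /(_ e%:C%C e0')/nbhs_realdist[d d0 hd] := proj1 (eqoP _ _ _) h'.
exists d => // t ht; have := hd (t - x); rewrite subr0 => /(_ ht).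
by rewrite !fctE /= subrK opprD addrA.
Qed.

(** The integral of f dz along the border of the rectangle [a, b] x [c, d],
    counterclockwise. *)
Definition rectint (f : C -> C) (a b c d : R) : C :=
  (cint a b (fun x => f (x +i* c)%C) - cint a b (fun x => f (x +i* d)%C))
  + 'i%C * (cint c d (fun y => f (b +i* y)%C) - cint c d (fun y => f (a +i* y)%C)).

Definition on_border (a b c d : R) (x y : R) :=
  [/\ a <= x <= b, c <= y <= d & [\/ x = a, x = b, y = c | y = d]].

Definition cont_border (f : C -> C) (a b c d : R) :=
  forall x y, on_border a b c d x y -> {for (x +i* y)%C, continuous f}.

Lemma cont_border_h1 f a b c d : c <= d -> cont_border f a b c d ->
  cont_on a b (fun x => f (x +i* c)%C).
Proof.
move=> cd h x hx; apply: (@continuous_comp _ _ _ (fun x => (x +i* c)%C : C) f).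
  exact: continuous_hline.
by apply: h; split=> //; [rewrite lexx|constructor 3].
Qed.

Lemma cont_border_h2 f a b c d : c <= d -> cont_border f a b c d ->
  cont_on a b (fun x => f (x +i* d)%C).
Proof.
move=> cd h x hx; apply: (@continuous_comp _ _ _ (fun x => (x +i* d)%C : C) f).
  exact: continuous_hline.
by apply: h; split=> //; [rewrite cd lexx|constructor 4].
Qed.

Lemma cont_border_v1 f a b c d : a <= b -> cont_border f a b c d ->
  cont_on c d (fun y => f (a +i* y)%C).
Proof.
move=> ab h x hx; apply: (@continuous_comp _ _ _ (fun y => (a +i* y)%C : C) f).
  exact: continuous_vline.
by apply: h; split=> //; [rewrite lexx|constructor 1].
Qed.

Lemma cont_border_v2 f a b c d : a <= b -> cont_border f a b c d ->
  cont_on c d (fun y => f (b +i* y)%C).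
Proof.
move=> ab h x hx; apply: (@continuous_comp _ _ _ (fun y => (b +i* y)%C : C) f).
  exact: continuous_vline.
by apply: h; split=> //; [rewrite ab lexx|constructor 2].
Qed.

Lemma cont_borderB (f g : C -> C) a b c d : cont_border f a b c d ->
  cont_border g a b c d -> cont_border (fun z => f z - g z) a b c d.
Proof. by move=> hf hg s t h; apply: continuousB; [exact: hf|exact: hg]. Qed.

Section Borders.
Variables (a b c d : R).
Hypotheses (ab : a <= b) (cd : c <= d).

Lemma rectintB f g : cont_border f a b c d -> cont_border g a b c d ->
  rectint (fun z => f z - g z) a b c d = rectint f a b c d - rectint g a b c d.
Proof.
move=> hf hg; rewrite /rectint.
rewrite (cintB (cont_border_h1 cd hf) (cont_border_h1 cd hg)).
rewrite (cintB (cont_border_h2 cd hf) (cont_border_h2 cd hg)).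
rewrite (cintB (cont_border_v1 ab hf) (cont_border_v1 ab hg)).
rewrite (cintB (cont_border_v2 ab hf) (cont_border_v2 ab hg)).
ring.
Qed.

Lemma rectintD f g : cont_border f a b c d -> cont_border g a b c d ->
  rectint (fun z => f z + g z) a b c d = rectint f a b c d + rectint g a b c d.
Proof.
move=> hf hg; rewrite /rectint.
rewrite (cintD (cont_border_h1 cd hf) (cont_border_h1 cd hg)).
rewrite (cintD (cont_border_h2 cd hf) (cont_border_h2 cd hg)).
rewrite (cintD (cont_border_v1 ab hf) (cont_border_v1 ab hg)).
rewrite (cintD (cont_border_v2 ab hf) (cont_border_v2 ab hg)).
ring.
Qed.

Lemma rectintZ k f : cont_border f a b c d ->
  rectint (fun z => k * f z) a b c d = k * rectint f a b c d.
Proof.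
move=> hf; rewrite /rectint.
rewrite (cintZ k (cont_border_h1 cd hf)) (cintZ k (cont_border_h2 cd hf)).
rewrite (cintZ k (cont_border_v1 ab hf)) (cintZ k (cont_border_v2 ab hf)).
ring.
Qed.

Lemma eq_rectint f g :
  (forall x y, on_border a b c d x y -> f (x +i* y)%C = g (x +i* y)%C) ->
  rectint f a b c d = rectint g a b c d.
Proof.
move=> h; rewrite /rectint; congr (_ - _ + _ * (_ - _)); apply: eq_cint => t ht.
- by apply: h; split=> //; [rewrite lexx|constructor 3].
- by apply: h; split=> //; [rewrite cd lexx|constructor 4].
- by apply: h; split=> //; [rewrite ab lexx|constructor 2].
- by apply: h; split=> //; [rewrite lexx|constructor 1].
Qed.

Lemma rectint_bound f (M : R) : cont_border f a b c d ->
  (forall x y, on_border a b c d x y -> `|f (x +i* y)%C| <= M%:C%C) ->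
  `|rectint f a b c d| <= (4 * M * ((b - a) + (d - c)))%:C%C.
Proof.
move=> hf hM; rewrite /rectint.
have b1 : `|cint a b (fun x => f (x +i* c)%C)| <= (M * (b - a) *+ 2)%:C%C.
  apply: cint_bound => //; first exact: cont_border_h1 hf.
  by move=> t ht; apply: hM; split=> //; [rewrite lexx|constructor 3].
have b2 : `|cint a b (fun x => f (x +i* d)%C)| <= (M * (b - a) *+ 2)%:C%C.
  apply: cint_bound => //; first exact: cont_border_h2 hf.
  by move=> t ht; apply: hM; split=> //; [rewrite cd lexx|constructor 4].
have b3 : `|cint c d (fun y => f (b +i* y)%C)| <= (M * (d - c) *+ 2)%:C%C.
  apply: cint_bound => //; first exact: cont_border_v2 hf.
  by move=> t ht; apply: hM; split=> //; [rewrite ab lexx|constructor 2].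
have b4 : `|cint c d (fun y => f (a +i* y)%C)| <= (M * (d - c) *+ 2)%:C%C.
  apply: cint_bound => //; first exact: cont_border_v1 hf.
  by move=> t ht; apply: hM; split=> //; [rewrite lexx|constructor 1].
have i1 : `|'i%C : C| = 1 by rewrite normc_def /= expr0n expr1n add0r sqrtr1.
apply: le_trans (ler_normD _ _) _; rewrite normrM i1 mul1r.
apply: le_trans (lerD (ler_normB _ _) (ler_normB _ _)) _.
apply: le_trans (lerD (lerD b1 b2) (lerD b3 b4)) _.
rewrite -!(rmorphD (real_complex R)) lecR le_eqVlt; apply/orP; left; apply/eqP.
ring.
Qed.

End Borders.

Lemma rectint_splitx f a m b c d : a <= m -> m <= b -> c <= d ->
  cont_border f a b c d ->
  rectint f a b c d = rectint f a m c d + rectint f m b c d.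
Proof.
move=> am mb cd hf; rewrite /rectint.
rewrite (cint_split am mb (cont_border_h1 cd hf)).
rewrite (cint_split am mb (cont_border_h2 cd hf)).
ring.
Qed.

Lemma rectint_splity f a b c m d : a <= b -> c <= m -> m <= d ->
  cont_border f a b c d ->
  rectint f a b c d = rectint f a b c m + rectint f a b m d.
Proof.
move=> ab cm md hf; rewrite /rectint.
rewrite (cint_split cm md (cont_border_v1 ab hf)).
rewrite (cint_split cm md (cont_border_v2 ab hf)).
ring.
Qed.

Lemma continuous_affine (k l : C) : continuous (fun z : C => k + l * z).
Proof.
move=> z; apply: continuousD; first exact: cst_continuous.
by apply: continuousM; [exact: cst_continuous|exact: cvg_id].
Qed.

(** On opposite sides an affine function differs by a constant, so the integrals
    are computed without any primitive. *)
Lemma rectint_affine (k l : C) a b c d : a <= b -> c <= d ->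
  rectint (fun z => k + l * z) a b c d = 0.
Proof.
move=> ab cd; rewrite /rectint.
have hb : cont_border (fun z => k + l * z) a b c d.
  by move=> x y _; exact: continuous_affine.
rewrite -(cintB (cont_border_h1 cd hb) (cont_border_h2 cd hb)).
rewrite -(cintB (cont_border_v2 ab hb) (cont_border_v1 ab hb)).
have aux1 (t u v i : C) : k + l * (t + i * u) - (k + l * (t + i * v)) =
    l * (i * (u - v)) by ring.
have aux2 (t u v i : C) : k + l * (u + i * t) - (k + l * (v + i * t)) =
    l * (u - v) by ring.
have aux3 (i u v u' v' : C) :
    l * (i * (u - v)) * (v' - u') + i * (l * (v' - u') * (v - u)) = 0 by ring.
rewrite (@eq_cint _ a b _ (fun=> l * ('i%C * (c%:C%C - d%:C%C)))); last first.
  by move=> t _; rewrite (plane_pointE t c) (plane_pointE t d); exact: aux1.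
rewrite (@eq_cint _ c d _ (fun=> l * (b%:C%C - a%:C%C))); last first.
  by move=> t _; rewrite (plane_pointE a t) (plane_pointE b t); exact: aux2.
rewrite (cint_cst _ ab) (cint_cst _ cd) !(rmorphB (real_complex R)); exact: aux3.
Qed.

Definition diff_rect (f : C -> C) (a b c d : R) :=
  forall x y, a <= x <= b -> c <= y <= d -> differentiable f ((x +i* y)%C : C).

Definition cont_rect (f : C -> C) (a b c d : R) :=
  forall x y, a <= x <= b -> c <= y <= d -> {for (x +i* y)%C, continuous f}.

Lemma diff_rect_cont f a b c d : diff_rect f a b c d -> cont_rect f a b c d.
Proof. by move=> h x y hx hy; apply: differentiable_continuous; exact: h. Qed.

Lemma cont_rect_sub f a b c d a' b' c' d' : cont_rect f a b c d ->
  a <= a' -> b' <= b -> c <= c' -> d' <= d -> cont_rect f a' b' c' d'.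
Proof.
move=> h aa bb cc dd x y /andP[ax xb] /andP[cy yd]; apply: h.
  by rewrite (le_trans aa ax) (le_trans xb bb).
by rewrite (le_trans cc cy) (le_trans yd dd).
Qed.

Lemma cont_rect_border f a b c d : cont_rect f a b c d -> cont_border f a b c d.
Proof. by move=> h x y [hx hy _]; exact: h. Qed.

(** One of the four quarters of a rectangle carries at least a quarter of its
    integral. *)
Lemma rectint_quarter f x y w h (e : R) : 0 <= w -> 0 <= h ->
  cont_rect f x (x + w) y (y + h) ->
  e%:C%C <= `|rectint f x (x + w) y (y + h)| ->
  exists x' y', [/\ (x' = x \/ x' = x + w / 2), (y' = y \/ y' = y + h / 2) &
    (e / 4)%:C%C <= `|rectint f x' (x' + w / 2) y' (y' + h / 2)|].
Proof.
move=> w0 h0 hf he.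
have w2 : 0 <= w / 2 by rewrite divr_ge0.
have h2 : 0 <= h / 2 by rewrite divr_ge0.
have ww : x + w / 2 + w / 2 = x + w by rewrite -addrA -splitr.
have hh : y + h / 2 + h / 2 = y + h by rewrite -addrA -splitr.
have xm : x <= x + w / 2 by rewrite lerDl.
have mx : x + w / 2 <= x + w by rewrite -ww lerDl.
have ym : y <= y + h / 2 by rewrite lerDl.
have my : y + h / 2 <= y + h by rewrite -hh lerDl.
have xw : x <= x + w by rewrite lerDl.
have yh : y <= y + h by rewrite lerDl.
rewrite (rectint_splitx xm mx yh (cont_rect_border hf)) in he.
rewrite (rectint_splity xm ym my) in he; last first.
  by apply: cont_rect_border; apply: cont_rect_sub hf _ _ _ _.
rewrite (rectint_splity mx ym my) in he; last first.
  by apply: cont_rect_border; apply: cont_rect_sub hf _ _ _ _.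
apply: contrapT => hn.
have small x' y' : (x' = x \/ x' = x + w / 2) -> (y' = y \/ y' = y + h / 2) ->
    `|rectint f x' (x' + w / 2) y' (y' + h / 2)| < (e / 4)%:C%C.
  move=> hx hy; rewrite normC_real ltcR ltNge; apply/negP => hle; apply: hn.
  by exists x', y'; split => //; rewrite normC_real lecR.
have s1 := small x y (or_introl erefl) (or_introl erefl).
have s2 := small x _ (or_introl erefl) (or_intror erefl).
have s3 := small _ y (or_intror erefl) (or_introl erefl).
have s4 := small _ _ (or_intror erefl) (or_intror erefl).
rewrite ww hh in s2 s3 s4.
have eq4 : (e / 4)%:C%C + (e / 4)%:C%C + ((e / 4)%:C%C + (e / 4)%:C%C) = e%:C%C :> C.
  by rewrite -!(rmorphD (real_complex R)); congr (_%:C)%C; field.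
have : e%:C%C < e%:C%C :> C.
  rewrite -{2}eq4; apply: le_lt_trans (ltrD (ltrD s1 s2) (ltrD s3 s4)).
  apply: le_trans he _; apply: le_trans (ler_normD _ _) _.
  by apply: lerD; exact: ler_normD.
by rewrite ltxx.
Qed.

Lemma nested_dyadic (u : nat -> R) (w : R) : 0 <= w ->
  (forall k, u k.+1 = u k \/ u k.+1 = u k + w / 2 ^+ k / 2) ->
  exists p, forall k, u k <= p <= u k + w / 2 ^+ k.
Proof.
move=> w0 hu.
have wk k : 0 <= w / 2 ^+ k by rewrite divr_ge0 ?exprn_ge0.
have wS k : w / 2 ^+ k.+1 = w / 2 ^+ k / 2 by rewrite exprSr invfM mulrA.
have up k : u k <= u k.+1 by case: (hu k) => -> //; rewrite lerDl divr_ge0.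
have dn k : u k.+1 + w / 2 ^+ k.+1 <= u k + w / 2 ^+ k.
  have := wk k; rewrite wS; case: (hu k) => ->; lra.
have upk j k : u j <= u (j + k)%N.
  by elim: k => [|k]; rewrite ?addn0 // addnS => /le_trans; apply.
have dnk j k : u (j + k)%N + w / 2 ^+ (j + k) <= u j + w / 2 ^+ j.
  by elim: k => [|k]; rewrite ?addn0 // addnS; apply: le_trans.
have cross j k : u j <= u k + w / 2 ^+ k.
  case: (leqP j k) => [/subnKC <-|/ltnW/subnKC <-].
    by apply: le_trans (upk j (k - j)%N) _; rewrite lerDl.
  by apply: le_trans (dnk k (j - k)%N); rewrite lerDl.
have ub k : ubound (range u) (u k + w / 2 ^+ k) by move=> _ [j _ <-]; exact: cross.
exists (sup (range u)) => k; apply/andP; split.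
  by apply: ub_le_sup; [exists (u 0%N + w / 2 ^+ 0); exact: ub|exists k].
by apply: ge_sup; [exists (u 0%N), 0%N|exact: ub].
Qed.

Lemma diff_scalar (f : C -> C) (p v : C) : 'd f p v = v * 'd f p 1.
Proof.
have /= h := @linearZ_LR _ _ _ _ ('d f p) v 1.
by rewrite -[in LHS](mulr1 v); exact: h.
Qed.

Lemma ler_realC_pM (e m : R) (x : C) :
  0 <= e -> x <= m%:C%C -> e%:C%C * x <= (e * m)%:C%C.
Proof.
move=> e0 xm; have -> : (e * m)%:C%C = e%:C%C * m%:C%C :> C by rewrite -rmorphM.
by apply: ler_wpM2l => //; rewrite lecR.
Qed.

(** Quarter the rectangle repeatedly, keeping a quarter whose integral is at least
    a fixed multiple of its squared size; near the limit point f is affine up to an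
    error that is small compared with the size, and affine functions integrate
    to zero.  Continuity of the derivative is not assumed anywhere, so this is the
    source of all regularity of holomorphic functions used below. *)
Lemma goursat f a b c d : a <= b -> c <= d -> diff_rect f a b c d ->
  rectint f a b c d = 0.
Proof.
move=> ab cd hf; apply/eqP; apply/negPn/negP => J0.
have half (v v' s lo hi : R) : 0 <= s -> lo <= v -> v + s <= hi ->
    (v' = v \/ v' = v + s / 2) -> lo <= v' /\ v' + s / 2 <= hi.
  by move=> ? ? ? [->|->]; split; lra.
have dist (v s q t : R) : v <= q <= v + s -> v <= t <= v + s -> `|t - q| <= s.
  by move=> ? ?; rewrite ler_norml; lra.
have last (s t : R) : 0 < s -> 0 <= t -> 4 * (s / (8 * (t + 1))) * t < s.
  move=> s0 t0; have t1 : 0 < 2 * (t + 1) by rewrite mulr_gt0 // ltr_wpDl.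
  have -> : 4 * (s / (8 * (t + 1))) * t = s * (t / (2 * (t + 1))).
    by field; rewrite gt_eqF // ltr_wpDl.
  by rewrite gtr_pMr // ltr_pdivrMr // mul1r; lra.
pose w := b - a; pose h := d - c.
have w0 : 0 <= w by rewrite subr_ge0.
have h0 : 0 <= h by rewrite subr_ge0.
have aw : a + w = b by rewrite addrC subrK.
have ch : c + h = d by rewrite addrC subrK.
pose eta := complex.Re `|rectint f a b c d|.
have eta0 : 0 < eta by rewrite -ltcR -normC_real normr_gt0.
(* Rectangles of the sequence are given by their lower left corners. *)
pose inv k (p : R * R) := [/\ a <= p.1, p.1 + w / 2 ^+ k <= b, c <= p.2,
  p.2 + h / 2 ^+ k <= d & (eta / 4 ^+ k)%:C%C <=
  `|rectint f p.1 (p.1 + w / 2 ^+ k) p.2 (p.2 + h / 2 ^+ k)|].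
pose next k (p q : R * R) := (q.1 = p.1 \/ q.1 = p.1 + w / 2 ^+ k / 2) /\
  (q.2 = p.2 \/ q.2 = p.2 + h / 2 ^+ k / 2).
have wk k : 0 <= w / 2 ^+ k by rewrite divr_ge0 ?exprn_ge0.
have hk k : 0 <= h / 2 ^+ k by rewrite divr_ge0 ?exprn_ge0.
have sS (v : R) k : v / 2 ^+ k.+1 = v / 2 ^+ k / 2 by rewrite exprSr invfM mulrA.
have step (kp : nat * (R * R)) : exists q : R * R,
    inv kp.1 kp.2 -> inv kp.1.+1 q /\ next kp.1 kp.2 q.
  case: kp => k p /=; have [ip|] := pselect (inv k p); last by exists p.
  case: (ip) => i1 i2 i3 i4 i5.
  have hr : cont_rect f p.1 (p.1 + w / 2 ^+ k) p.2 (p.2 + h / 2 ^+ k).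
    exact: cont_rect_sub (diff_rect_cont hf) _ _ _ _.
  have [x [y [hx hy hxy]]] := rectint_quarter (wk k) (hk k) hr i5.
  exists (x, y) => _; split; last by split.
  have e4 : eta / 4 ^+ k.+1 = eta / 4 ^+ k / 4 by rewrite exprSr invfM mulrA.
  have [? ?] := half _ _ _ _ _ (wk k) i1 i2 hx.
  have [? ?] := half _ _ _ _ _ (hk k) i3 i4 hy.
  by rewrite /inv /= e4 !sS; split.
have [F hF] := choice step.
pose u := fix u k := if k is k'.+1 then F (k', u k') else (a, c).
have uP k : inv k (u k).
  elim: k => [|k /(hF (k, _))[]//]; rewrite /inv /= !expr0 !divr1 aw ch !lexx.
  by split => //; rewrite -normC_real.
have uN k : next k (u k) (u k.+1) by case: (hF (k, u k) (uP k)).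
(* The limit point of the nested rectangles. *)
have [px hpx] := nested_dyadic w0 (fun k => proj1 (uN k)).
have [py hpy] := nested_dyadic h0 (fun k => proj2 (uN k)).
pose p : C := (px +i* py)%C.
have dp : differentiable f p.
  apply: hf.
    by have := hpx 0%N; rewrite expr0 divr1 /= aw.
  by have := hpy 0%N; rewrite expr0 divr1 /= ch.
pose L := w + h.
have L0 : 0 <= L by rewrite addr_ge0.
(* On a rectangle of size s the error e s integrates to at most 4 e s^2; the
   summand 1 covers a degenerate rectangle. *)
pose e := eta / (8 * (L ^+ 2 + 1)).
have e0 : 0 < e by rewrite divr_gt0 // mulr_gt0 // ltr_wpDl // sqr_ge0.
have [dl dl0 hdl] := differentiable_slope dp e0.
have [k Lk] : exists k, L / 2 ^+ k < dl.
  have /cvgr0Pnorm_lt/(_ _ dl0)[k _ /(_ k)] : (fun k => L / 2 ^+ k) @ \oo --> (0 : R).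
    rewrite -[X in _ --> X](mulr0 L); apply: cvgM; first exact: cvg_cst.
    rewrite (_ : (fun _ => _) = (fun k => (2^-1) ^+ k)); last by apply/funext => k; rewrite exprVn.
    by apply: cvg_expr; rewrite ger0_norm ?invf_lt1 ?ltr1n.
  by rewrite /= => /(_ (leqnn _)) h'; exists k; apply: le_lt_trans h'; exact: ler_norm.
have [i1 i2 i3 i4 i5] := uP k.
set x := (u k).1 in i1 i2 i5; set y := (u k).2 in i3 i4 i5.
have hr : cont_rect f x (x + w / 2 ^+ k) y (y + h / 2 ^+ k).
  exact: cont_rect_sub (diff_rect_cont hf) _ _ _ _.
pose l := 'd f p 1; pose g z := (f p - l * p) + l * z.
have cg : continuous g by exact: continuous_affine.
have xx : x <= x + w / 2 ^+ k by rewrite lerDl.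
have yy : y <= y + h / 2 ^+ k by rewrite lerDl.
have hg : cont_border g x (x + w / 2 ^+ k) y (y + h / 2 ^+ k).
  by move=> s t _; exact: cg.
have := rectint_affine (f p - l * p) l xx yy; rewrite -/g => g0.
have := rectintB xx yy (cont_rect_border hr) hg; rewrite g0 subr0 => eqJ.
have bnd : forall s t, on_border x (x + w / 2 ^+ k) y (y + h / 2 ^+ k) s t ->
    `|f (s +i* t)%C - g (s +i* t)%C| <= (e * (L / 2 ^+ k))%:C%C.
  move=> s t [hs ht _]; set z : C := (s +i* t)%C.
  have zp : `|z - p| <= (L / 2 ^+ k)%:C%C.
    apply: le_trans (normC_le_ReIm _) _; rewrite lecR /L mulrDl /=.
    by apply: lerD; [exact: dist (hpx k) hs|exact: dist (hpy k) ht].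
  have -> : f z - g z = f z - f p - 'd f p (z - p).
    have -> : 'd f p (z - p) = l * (z - p).
      by rewrite diff_scalar mulrC.
    rewrite /g; ring.
  apply: le_trans (hdl _ _) _.
    by apply: le_lt_trans zp _; rewrite ltcR.
  exact: ler_realC_pM (ltW e0) zp.
have hfg : cont_border (fun z => f z - g z) x (x + w / 2 ^+ k) y (y + h / 2 ^+ k).
  exact: cont_borderB (cont_rect_border hr) hg.
have := rectint_bound xx yy hfg bnd; rewrite eqJ => hle.
have := le_trans i5 hle; rewrite lecR leNgt => /negP; apply.
rewrite [x + _ - _]addrAC subrr add0r [y + _ - _]addrAC subrr add0r -mulrDl -/L.
have -> : 4 * (e * (L / 2 ^+ k)) * (L / 2 ^+ k) = (4 * e * L ^+ 2) / 4 ^+ k.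
  rewrite (_ : 4 ^+ k = 2 ^+ k * 2 ^+ k :> R); last by rewrite -exprMn -natrM.
  by field; rewrite expf_neq0.
rewrite ltr_pM2r ?invr_gt0 ?exprn_gt0 //.
exact: last eta0 (sqr_ge0 L).
Qed.

End Goursat.

(** * Integrals with parameters and punctured rectangles *)

Section CauchyExpansion.
Variable R : realType.
Local Notation C := (Cplx R).
Local Notation Re := (@complex.Re R).
Local Notation Im := (@complex.Im R).

(** Compactness of the segment makes the convergence of the integrand uniform. *)
Lemma cint_continuous (T : topologicalType) (G : T -> R -> C) (t0 : T) (a b : R) :
  a <= b ->
  (forall s, a <= s <= b -> {for (t0, s), continuous (fun p : T * R => G p.1 p.2)}) ->
  (\forall t \near t0, cont_on a b (G t)) ->
  {for t0, continuous (fun t => cint a b (G t))}.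
Proof.
move=> ab hG hcont; apply/(@cvg_realdist R C^o _ _ (nbhs_filter t0)) => e e0.
pose e' := e / (2 * (b - a) + 1).
have l0 : 0 <= b - a by rewrite subr_ge0.
have e'0 : 0 < e' by rewrite divr_gt0 // ltr_wpDl // mulr_ge0.
have e'e : e' * (b - a) *+ 2 < e.
  have l1 : 0 < 2 * (b - a) + 1 by rewrite ltr_wpDl // mulr_ge0.
  have -> : e' * (b - a) *+ 2 = e * (2 * (b - a) / (2 * (b - a) + 1)).
    by rewrite /e' -mulr_natl; field; rewrite gt_eqF.
  by rewrite gtr_pMr // ltr_pdivrMr // mul1r ltrDl.
have /compact_near_coveringP cov := @segment_compact R a b.
have /(_ _) h := cov T (nbhs t0) (fun t s => `|G t s - G t0 s| <= e'%:C%C) (nbhs_filter t0).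
have {}h : \forall t \near t0, `[a, b] `<=` (fun s => `|G t s - G t0 s| <= e'%:C%C).
  apply: h => s; rewrite /= in_itv /= => /hG hs.
  have e20 : 0 < e' / 2 by rewrite divr_gt0.
  have := proj1 (@cvg_realdist R C^o _ _ (nbhs_filter (t0, s)) _ _) hs _ e20.
  case=> -[A B] /= [At Bs] AB; exists (B, A) => //= -[s' t] [/= Bs' At'].
  have h1 := AB (t, s') (conj At' Bs').
  have h2 := AB (t0, s') (conj (nbhs_singleton At) Bs').
  rewrite /= in h1 h2; rewrite -(subrKA (G t0 s)).
  have -> : e'%:C%C = (e' / 2)%:C%C + (e' / 2)%:C%C :> C.
    by rewrite -(rmorphD (real_complex R)) /= -splitr.
  apply: le_trans (ler_normD _ _) _; apply: lerD; first exact: ltW.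
  by rewrite distrC; exact: ltW.
have c0 : cont_on a b (G t0) by exact: nbhs_singleton hcont.
move: h hcont; apply: filterS2 => t ht ct.
rewrite -(cintB ct c0); apply: le_lt_trans (_ : _ <= (e' * (b - a) *+ 2)%:C%C) _.
  apply: (@cint_bound R a b (fun s => G t s - G t0 s) e' ab).
    by move=> s hs; apply: continuousB; [exact: ct|exact: c0].
  by move=> s hs; apply: ht; rewrite /= in_itv.
by rewrite ltcR.
Qed.

Lemma rectint_continuous (T : topologicalType) (H : T -> C -> C) (t0 : T) a b c d :
  a <= b -> c <= d ->
  (forall x y, on_border a b c d x y ->
     {for (t0, (x +i* y)%C : C), continuous (fun p : T * C => H p.1 p.2)}) ->
  (\forall t \near t0, cont_border (H t) a b c d) ->
  {for t0, continuous (fun t => rectint (H t) a b c d)}.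
Proof.
move=> ab cd hH hc.
have side (g : R -> C) (p q : R) : p <= q -> continuous g ->
    (forall s, p <= s <= q -> {for (t0, g s), continuous (fun p : T * C => H p.1 p.2)}) ->
    (\forall t \near t0, cont_on p q (H t \o g)) ->
    {for t0, continuous (fun t => cint p q (H t \o g))}.
  move=> pq cg hg; apply: cint_continuous => // s hs.
  apply: (@continuous_comp _ _ _ (fun u : T * R => (u.1, g u.2)) (fun p => H p.1 p.2)).
    apply: continuous_pair; first exact: cvg_fst.
    by apply: (@continuous_comp _ _ _ snd g); [exact: cvg_snd|exact: cg].
  exact: hg.
have c1 : {for t0, continuous (fun t => cint a b (fun x => H t (x +i* c)%C))}.
  apply: (side _ _ _ ab (@continuous_hline R c)).
    by move=> s hs; apply: hH; split=> //; [rewrite lexx|constructor 3].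
  by move: hc; apply: filterS => t; exact: cont_border_h1.
have c2 : {for t0, continuous (fun t => cint a b (fun x => H t (x +i* d)%C))}.
  apply: (side _ _ _ ab (@continuous_hline R d)).
    by move=> s hs; apply: hH; split=> //; [rewrite cd lexx|constructor 4].
  by move: hc; apply: filterS => t; exact: cont_border_h2.
have c3 : {for t0, continuous (fun t => cint c d (fun y => H t (b +i* y)%C))}.
  apply: (side _ _ _ cd (@continuous_vline R b)).
    by move=> s hs; apply: hH; split=> //; [rewrite ab lexx|constructor 2].
  by move: hc; apply: filterS => t; exact: cont_border_v2.
have c4 : {for t0, continuous (fun t => cint c d (fun y => H t (a +i* y)%C))}.
  apply: (side _ _ _ cd (@continuous_vline R a)).
    by move=> s hs; apply: hH; split=> //; [rewrite lexx|constructor 1].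
  by move: hc; apply: filterS => t; exact: cont_border_v1.
apply: continuousD_C; first exact: continuousB_C c1 c2.
by apply: continuousM_C; [exact: cst_continuous|exact: continuousB_C c3 c4].
Qed.

(** Cutting the rectangle along the sides of a small square around the exceptional
    point leaves only that square, whose border integral is of the order of its
    size because f is bounded there. *)
Lemma goursat_punctured (f : C -> C) a b c d x0 y0 (M dl : R) :
  a < x0 < b -> c < y0 < d -> 0 < dl ->
  (forall x y, a <= x <= b -> c <= y <= d -> (x != x0) || (y != y0) ->
     differentiable f ((x +i* y)%C : C)) ->
  (forall x y, `|x - x0| <= dl -> `|y - y0| <= dl -> `|f (x +i* y)%C| <= M%:C%C) ->
  rectint f a b c d = 0.
Proof.
move=> /andP[ax xb] /andP[cy yd] dl0 hf hM.
have small (e : R) : 0 < e -> e <= dl -> a <= x0 - e -> x0 + e <= b ->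
    c <= y0 - e -> y0 + e <= d -> `|rectint f a b c d| <= (16 * M * e)%:C%C.
  move=> e0 edl h1 h2 h3 h4.
  have contf x y : a <= x <= b -> c <= y <= d -> (x != x0) || (y != y0) ->
      {for (x +i* y)%C, continuous f}.
    by move=> hx hy hxy; apply: differentiable_continuous; exact: hf.
  have bord x1 x2 y1 y2 : a <= x1 -> x2 <= b -> c <= y1 -> y2 <= d ->
      x1 != x0 -> x2 != x0 -> y1 != y0 -> y2 != y0 -> cont_border f x1 x2 y1 y2.
    move=> ax1 xb1 cy1 yd1 n1 n2 n3 n4 x y [/andP[u1 u2] /andP[v1 v2] hxy].
    apply: contf.
    - by rewrite (le_trans ax1 u1) (le_trans u2 xb1).
    - by rewrite (le_trans cy1 v1) (le_trans v2 yd1).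
    - by case: hxy => ->; rewrite ?n1 ?n2 ?n3 ?n4 ?orbT.
  have zero x1 x2 y1 y2 : x1 <= x2 -> y1 <= y2 -> a <= x1 -> x2 <= b -> c <= y1 -> y2 <= d ->
      [\/ x2 < x0, x0 < x1, y2 < y0 | y0 < y1] -> rectint f x1 x2 y1 y2 = 0.
    move=> x12 y12 ax1 xb1 cy1 yd1 hor; apply: goursat => // x y /andP[u1 u2] /andP[v1 v2].
    apply: hf.
    - by rewrite (le_trans ax1 u1) (le_trans u2 xb1).
    - by rewrite (le_trans cy1 v1) (le_trans v2 yd1).
    - apply/orP; case: hor => h; [left|left|right|right].
      + by rewrite lt_eqF // (le_lt_trans u2 h).
      + by rewrite gt_eqF // (lt_le_trans h u1).
      + by rewrite lt_eqF // (le_lt_trans v2 h).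
      + by rewrite gt_eqF // (lt_le_trans h v1).
  have xm : x0 - e < x0 by rewrite ltrBlDr ltrDl.
  have xp : x0 < x0 + e by rewrite ltrDl.
  have ym : y0 - e < y0 by rewrite ltrBlDr ltrDl.
  have yp : y0 < y0 + e by rewrite ltrDl.
  have xmp : x0 - e <= x0 + e by rewrite ltW // (lt_trans xm xp).
  have ymp : y0 - e <= y0 + e by rewrite ltW // (lt_trans ym yp).
  have nxm : x0 - e != x0 by rewrite lt_eqF.
  have nxp : x0 + e != x0 by rewrite gt_eqF.
  have nym : y0 - e != y0 by rewrite lt_eqF.
  have nyp : y0 + e != y0 by rewrite gt_eqF.
  have na : a != x0 by rewrite lt_eqF.
  have nb : b != x0 by rewrite gt_eqF.
  have nc : c != y0 by rewrite lt_eqF.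
  have nd : d != y0 by rewrite gt_eqF.
  have ab : x0 - e <= b := le_trans xmp h2.
  have cd : c <= d := ltW (lt_trans cy yd).
  have cd' : y0 - e <= d := le_trans ymp h4.
  rewrite (rectint_splitx h1 ab cd); last exact: bord.
  rewrite (zero a (x0 - e)) ?add0r //; last by constructor 1.
  rewrite (rectint_splitx xmp h2 cd); last exact: bord.
  rewrite [X in _ + X](zero (x0 + e) b) ?addr0 //; last 2 first.
  - exact: le_trans h1 xmp.
  - by constructor 2.
  rewrite (rectint_splity xmp h3 cd'); last exact: bord.
  rewrite (zero _ _ c (y0 - e)) ?add0r //; last by constructor 3.
  rewrite (rectint_splity xmp ymp h4); last exact: bord.
  rewrite [X in _ + X](zero _ _ (y0 + e) d) ?addr0 //; last 2 first.
  - exact: le_trans h3 ymp.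
  - by constructor 4.
  have -> : 16 * M * e = 4 * M * ((x0 + e - (x0 - e)) + (y0 + e - (y0 - e))) by ring.
  apply: rectint_bound => //; first exact: bord.
  move=> x y [hx hy _]; apply: hM; rewrite ler_norml.
    by apply/andP; split; [have /andP[] := hx|have /andP[] := hx]; lra.
  by apply/andP; split; [have /andP[] := hy|have /andP[] := hy]; lra.
pose e1 := Num.min dl (Num.min (Num.min (x0 - a) (b - x0)) (Num.min (y0 - c) (d - y0))).
have e10 : 0 < e1 by rewrite !lt_min dl0 !subr_gt0 ax xb cy yd.
have M0 : 0 <= M.
  have z0 (t : R) : `|t - t| <= dl by rewrite subrr normr0 ltW.
  have := le_trans (normr_ge0 _) (hM x0 y0 (z0 x0) (z0 y0)).
  by rewrite (_ : 0 = 0%:C%C) // lecR.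
have small2 e : 0 < e -> e <= e1 -> `|rectint f a b c d| <= (16 * M * e)%:C%C.
  move=> e0; rewrite /e1 !le_min => /andP[? /andP[/andP[? ?] /andP[? ?]]].
  apply: small => //; lra.
apply/eqP; rewrite -normr_le0 normC_real lecR leNgt; apply/negP => J0.
set j := complex.Re _ in J0.
pose e2 := Num.min e1 (j / (16 * M + 1)).
have M1 : 0 < 16 * M + 1 by rewrite ltr_wpDl // mulr_ge0.
have e20 : 0 < e2 by rewrite lt_min e10 divr_gt0.
have := small2 _ e20; rewrite ge_min lexx => /(_ isT).
rewrite normC_real lecR -/j leNgt => /negP; apply.
apply: le_lt_trans (_ : _ <= 16 * M * (j / (16 * M + 1))) _.
  by apply: ler_wpM2l; rewrite ?mulr_ge0 // ge_min lexx orbT.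
rewrite mulrA ltr_pdivrMr //; nra.
Qed.

End CauchyExpansion.

(** * Taylor expansion on a square *)

Section SquareExpansion.
Variable R : realType.
Local Notation C := (Cplx R).
Local Notation Re := (@complex.Re R).
Local Notation Im := (@complex.Im R).

(** The integral along the border of the square [-r, r] x [-r, r]. *)
Definition sqint (r : R) (f : C -> C) : C := rectint f (- r) r (- r) r.

Variable r : R.
Hypothesis r0 : 0 < r.

Let rr : - r <= r.
Proof. by rewrite ge0_cp // ltW. Qed.

Lemma border_norm x y : on_border (- r) r (- r) r x y -> r%:C%C <= `|(x +i* y)%C : C|.
Proof.
move=> [_ _ h]; set z : C := (x +i* y)%C.
have re : `|x|%:C%C <= `|z| by exact: (normC_Re z).
have im : `|y|%:C%C <= `|z| by exact: (normC_Im z).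
have nr : `|r| = r by rewrite gtr0_norm.
by case: h => hx; [have := re|have := re|have := im|have := im];
  rewrite hx ?normrN nr.
Qed.

Lemma border_neq (z : C) x y : on_border (- r) r (- r) r x y -> `|z| < r%:C%C ->
  (x +i* y)%C != z.
Proof.
move=> /border_norm h hz; apply/negP => /eqP e; move: h; rewrite e => h.
by have := le_lt_trans h hz; rewrite ltxx.
Qed.

Lemma border_dist (z : C) x y : on_border (- r) r (- r) r x y ->
  `|z| <= (r / 2)%:C%C -> (r / 2)%:C%C <= `|(x +i* y)%C - z|.
Proof.
move=> /border_norm h hz; rewrite -(lerD2r `|z|).
apply: le_trans (_ : r%:C%C <= _).
  have -> : r%:C%C = (r / 2)%:C%C + (r / 2)%:C%C :> C.
    by rewrite -(rmorphD (real_complex R)) /= -splitr.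
  by rewrite lerD2l.
by apply: le_trans h _; rewrite -{1}(subrK z (x +i* y)%C); exact: ler_normD.
Qed.

Lemma half_lt (z : C) : `|z| <= (r / 2)%:C%C -> `|z| < r%:C%C.
Proof. by move=> h; apply: le_lt_trans h _; rewrite ltcR ltr_pdivrMr // mulr_natr mulr2n ltrDl. Qed.

Lemma continuous_kernel (z w : C) : w != z -> {for w, continuous (fun v : C => (v - z)^-1)}.
Proof.
move=> wz; apply: continuousV_C; last by rewrite subr_eq0.
by apply: continuousB_C; [exact: cvg_id|exact: cst_continuous].
Qed.

Lemma cont_border_kernel (z : C) : `|z| < r%:C%C ->
  cont_border (fun w => (w - z)^-1) (- r) r (- r) r.
Proof. by move=> hz x y h; apply: continuous_kernel; exact: border_neq h hz. Qed.

Lemma cint_real a b (g : R -> R) :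
  cint a b (fun t => (g t)%:C%C) = (rint a b g)%:C%C.
Proof.
rewrite /cint (_ : Im \o _ = fun=> 0); last by apply/funext.
by rewrite {2}/rint Rintegral_cst // mul0r.
Qed.

(** The two pairs of opposite sides each combine to the integral of
    2r / (t^2 + r^2), which is at least 2.  Any positive bound would serve: the
    integral only has to be nonzero, as the factor in Cauchy's formula. *)
Lemma sqint_inv_ge4 : (4%:R : C) <= `|sqint r (fun w => w^-1)|.
Proof.
pose g (t : R) : R := 2 * r / (t ^+ 2 + r ^+ 2).
have den t : 0 < t ^+ 2 + r ^+ 2 by rewrite ltr_wpDl ?sqr_ge0 // exprn_gt0.
have nul : `|0 : C| < r%:C%C by rewrite normr0 ltcR.
have cb : cont_border (fun w : C => w^-1) (- r) r (- r) r.
  have := cont_border_kernel nul; rewrite (_ : (fun w => _) = (fun w => w^-1)) //.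
  by apply/funext => w; rewrite subr0.
have gc : rcont_on (- r) r g.
  move=> t _; rewrite /g; apply: cvgM; first exact: cvg_cst.
  apply: cvgV; first by rewrite gt_eqF.
  apply: cvgD; last exact: cvg_cst.
  by rewrite (_ : (fun t => t ^+ 2) = (fun t => t * t)) //; apply: cvgM; exact: cvg_id.
have invE (x y : R) : ((x +i* y)%C : C)^-1 =
    (x / (x ^+ 2 + y ^+ 2) -i* (y / (x ^+ 2 + y ^+ 2)))%C by [].
have eh t : ((t -i* r)%C : C)^-1 - ((t +i* r)%C : C)^-1 = 'i%C * (g t)%:C%C.
  rewrite !invE sqrrN /g; apply/eqP; rewrite eq_complex /=; apply/andP.
  by split; apply/eqP; field; rewrite gt_eqF.
have ev t : ((r +i* t)%C : C)^-1 - (((- r) +i* t)%C : C)^-1 = (g t)%:C%C.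
  rewrite !invE sqrrN [r ^+ 2 + _]addrC /g; apply/eqP; rewrite eq_complex /=; apply/andP.
  by split; apply/eqP; field; rewrite gt_eqF.
have e1 : sqint r (fun w => w^-1) = 'i%C * (rint (- r) r g *+ 2)%:C%C.
  rewrite /sqint /rectint.
  rewrite -(cintB (cont_border_h1 rr cb) (cont_border_h2 rr cb)).
  rewrite -(cintB (cont_border_v2 rr cb) (cont_border_v1 rr cb)).
  have hz : cont_on (- r) r (fun t => (g t)%:C%C : C).
    move=> t ht; apply: (@continuous_comp _ _ _ g); first exact: gc.
    exact: continuous_real_complex.
  rewrite (@eq_cint _ _ _ _ (fun t => 'i%C * (g t)%:C%C)); last by move=> t _; exact: eh.
  rewrite (@eq_cint _ _ _ (fun y => ((r +i* y)%C)^-1 - _) (fun t => (g t)%:C%C)); last first.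
    by move=> t _; exact: ev.
  by rewrite (cintZ _ hz) cint_real mulr2n (rmorphD (real_complex R)) /= mulrDr.
have i1 : `|'i%C : C| = 1 by rewrite normc_def /= expr0n expr1n add0r sqrtr1.
have g2 : 2 <= rint (- r) r g.
  have -> : 2 = rint (- r) r (fun=> r^-1).
    by rewrite rint_cst //; field; rewrite gt_eqF.
  apply: le_Rintegral => //; try exact: rcont_integrable.
    by apply: rcont_integrable => t _; exact: cvg_cst.
  move=> t; rewrite /= in_itv /= => /andP[h1 h2].
  rewrite /g ler_pdivlMr // mulrC ler_pdivrMr // -mulrA; nra.
rewrite e1 normrM i1 mul1r normCR -(rmorph_nat (real_complex R)) lecR.
apply: le_trans (ler_norm _); rewrite mulr2n.
by move: (rint _ _ _) g2 => q q2; clear -q2; lra.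
Qed.

Lemma sqint_bound f (M : R) : cont_border f (- r) r (- r) r ->
  (forall x y, on_border (- r) r (- r) r x y -> `|f (x +i* y)%C| <= M%:C%C) ->
  `|sqint r f| <= (16 * M * r)%:C%C.
Proof.
move=> hf hM; have -> : 16 * M * r = 4 * M * ((r - - r) + (r - - r)) by ring.
exact: rectint_bound.
Qed.

(** For small z the kernel is uniformly close to 1/w on the border, so that its
    integral stays away from 0.  This replaces the computation of a winding number. *)
Lemma sqint_kernel_neq0 (z : C) : `|z| < (r / 8)%:C%C ->
  sqint r (fun w => (w - z)^-1) != 0.
Proof.
move=> hz; have num (q n : R) : n < q / 8 -> 32 * n < 4 * q by lra.
have z2 : `|z| <= (r / 2)%:C%C.
  have r82 : r / 8 <= r / 2 by move: r0; move: r => q q0; lra.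
  by apply: ltW; apply: lt_le_trans hz _; rewrite lecR.
have nul : `|0 : C| < r%:C%C by rewrite normr0 ltcR.
have cb0 : cont_border (fun w : C => w^-1) (- r) r (- r) r.
  have := cont_border_kernel nul; rewrite (_ : (fun w => _) = (fun w => w^-1)) //.
  by apply/funext => w; rewrite subr0.
have cbz := cont_border_kernel (half_lt z2).
apply/negP => /eqP e0.
have := rectintB rr rr cb0 cbz; rewrite -/(sqint r _) -/(sqint r _) -/(sqint r _) e0 subr0 => e1.
have [m zm] : {m : R | `|z| = m%:C%C} by exists (Re `|z|); exact: normC_real.
have m8 : m < r / 8 by move: hz; rewrite zm ltcR.
have m0 : 0 <= m by rewrite -realC_ge0 -zm normr_ge0.
have := sqint_inv_ge4; rewrite -e1 => h4.
have := @sqint_bound (fun w => w^-1 - (w - z)^-1) (m * (2 / r ^+ 2))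
  (cont_borderB cb0 cbz) _.
have bnd x y : on_border (- r) r (- r) r x y ->
    `|((x +i* y)%C : C)^-1 - ((x +i* y)%C - z)^-1| <= (m * (2 / r ^+ 2))%:C%C.
  move=> h; set w : C := (x +i* y)%C.
  have w0 : w != 0 by exact: border_neq h nul.
  have wz : w - z != 0 by rewrite subr_eq0; exact: border_neq h (half_lt z2).
  have -> : w^-1 - (w - z)^-1 = - z * (w^-1 * (w - z)^-1) by field; rewrite w0 wz.
  have r20 : 0 < r / 2 by rewrite divr_gt0.
  have hw : `|w^-1| <= (r^-1)%:C%C by apply: norm_inv_le => //; exact: border_norm h.
  have hwz : `|(w - z)^-1| <= ((r / 2)^-1)%:C%C.
    by apply: norm_inv_le => //; exact: border_dist h z2.
  rewrite normrM normrN zm (rmorphM (real_complex R)) /=.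
  apply: ler_wpM2l; first by rewrite lecR.
  rewrite normrM; have -> : 2 / r ^+ 2 = r^-1 * (r / 2)^-1.
    by field; rewrite gt_eqF.
  rewrite (rmorphM (real_complex R)) /=; exact: ler_pM.
move=> /(_ bnd) hle; have := le_trans h4 hle.
rewrite -(rmorph_nat (real_complex R)) lecR leNgt => /negP; apply.
have -> : 16 * (m * (2 / r ^+ 2)) * r = 32 * m / r by field; rewrite gt_eqF.
by rewrite ltr_pdivrMr //; exact: num.
Qed.

(** R_k(z), the integral of f(w) / (w^k (w - z)) dw.  Up to the nonzero factor of
    Cauchy's formula, R_k(0) is the k-th Taylor coefficient of f at 0 and z^k R_k(z)
    is the remainder of order k; keeping both in one family makes the expansion
    a single recursion. *)
Definition taylor_rem (f : C -> C) (k : nat) (z : C) : C :=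
  sqint r (fun w => f w * (w ^+ k * (w - z))^-1).

Lemma cont_border_taylor f k (z : C) : `|z| < r%:C%C ->
  cont_border f (- r) r (- r) r ->
  cont_border (fun w => f w * (w ^+ k * (w - z))^-1) (- r) r (- r) r.
Proof.
move=> hz hf x y h; have nul : `|0 : C| < r%:C%C by rewrite normr0 ltcR.
apply: (@continuousM_C R C _ f (fun w => (w ^+ k * (w - z))^-1)); first exact: hf.
apply: (@continuousV_C R C _ (fun w => w ^+ k * (w - z))).
  apply: (@continuousM_C R C _ (fun w => w ^+ k) (fun w => w - z)).
    by apply: (@continuousX_C R C _ id); exact: cvg_id.
  apply: (@continuousB_C R C _ id (fun=> z)); first exact: cvg_id.
  exact: cst_continuous.
by rewrite mulf_neq0 ?expf_neq0 ?subr_eq0 //; exact: border_neq h _.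
Qed.

(** The identity 1/(w^k (w - z)) = 1/w^(k+1) + z/(w^(k+1) (w - z)), integrated. *)
Lemma taylor_remS f k (z : C) : `|z| < r%:C%C -> cont_border f (- r) r (- r) r ->
  taylor_rem f k z = taylor_rem f k 0 + z * taylor_rem f k.+1 z.
Proof.
move=> hz hf; have nul : `|0 : C| < r%:C%C by rewrite normr0 ltcR.
have c1 := @cont_border_taylor f k 0 nul hf.
have c2 := @cont_border_taylor f k.+1 z hz hf.
have c3 : cont_border (fun w => z * (f w * (w ^+ k.+1 * (w - z))^-1)) (- r) r (- r) r.
  move=> x y h.
  apply: (@continuousM_C R C _ (fun=> z) (fun w => f w * (w ^+ k.+1 * (w - z))^-1)).
    exact: cst_continuous.
  exact: c2.
rewrite /taylor_rem /sqint -(rectintZ rr rr z c2) -(rectintD rr rr c1 c3).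
apply: eq_rectint => // x y h; set w : C := (x +i* y)%C.
have w0 : w != 0 by exact: border_neq h nul.
have wz : w - z != 0 by rewrite subr_eq0; exact: border_neq h hz.
have wk : w ^+ k != 0 by rewrite expf_neq0.
by rewrite exprS subr0; field; rewrite w0 wz wk.
Qed.

(** Cauchy's formula: the difference quotient of f at z is bounded, so its border
    integral is zero. *)
Lemma cauchy_square f (z : C) : diff_rect f (- r) r (- r) r -> `|z| < r%:C%C ->
  taylor_rem f 0 z = f z * sqint r (fun w => (w - z)^-1).
Proof.
have num (q : R) : 0 < q -> q / 3 + q / 3 < q by lra.
move=> hf hz.
have cf := cont_rect_border (diff_rect_cont hf).
have ck := cont_border_kernel hz.
have c1 := @cont_border_taylor f 0 z hz cf.
have c2 : cont_border (fun w => f z * (w - z)^-1) (- r) r (- r) r.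
  move=> x y h; apply: (@continuousM_C R C _ (fun=> f z) (fun w => (w - z)^-1)).
    exact: cst_continuous.
  exact: ck.
apply/eqP; rewrite /taylor_rem -subr_eq0 /sqint -(rectintZ rr rr (f z) ck).
rewrite -(rectintB rr rr c1 c2); apply/eqP.
have hin (t : R) : `|t|%:C%C <= `|z| -> - r < t < r.
  by move=> h; rewrite -ltr_norml -ltcR; exact: le_lt_trans h hz.
have zx := hin _ (normC_Re z); have zy := hin _ (normC_Im z).
have dfz : differentiable f z.
  have := hf (Re z) (Im z); case: (z) zx zy => zx' zy' /= /andP[/ltW -> /ltW ->] /andP[/ltW -> /ltW ->].
  exact.
(* Bound of the difference quotient near z. *)
have [dl dl0 hdl] := differentiable_slope dfz (@ltr01 R).
pose M := Re `|'d f z 1| + 1.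
apply: (@goursat_punctured R _ _ _ _ _ (Re z) (Im z) M (dl / 3) zx zy).
- by rewrite divr_gt0.
- move=> x y hx hy hxy; set w : C := (x +i* y)%C.
  have wz : w - z != 0.
    rewrite subr_eq0; apply: contraL hxy => /eqP <- /=; by rewrite !eqxx.
  have -> : (fun w => f w * (w ^+ 0 * (w - z))^-1 - f z * (w - z)^-1) =
      (fun w => (f w - f z) * (w - z)^-1).
    by apply/funext => v; rewrite expr0 mul1r mulrBl.
  apply: (@differentiableM C C^o (fun w => f w - f z) (fun w => (w - z)^-1)).
    apply: (@differentiableB C C^o C^o f (cst (f z))); first exact: hf.
    exact: differentiable_cst.
  apply: (@differentiableV C C^o (fun w => w - z)); last exact: wz.
  apply: (@differentiableB C C^o C^o id (cst z)); last exact: differentiable_cst.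
  exact: ex_diff.
move=> x y hx hy; set w : C := (x +i* y)%C.
rewrite expr0 mul1r -mulrBl.
have wd : `|w - z| < dl%:C%C.
  apply: le_lt_trans (normC_le_ReIm _) _; rewrite ltcR.
  have -> : Re (w - z) = x - Re z by case: (z).
  have -> : Im (w - z) = y - Im z by case: (z).
  by apply: le_lt_trans (lerD hx hy) _; exact: num.
have := hdl w wd; rewrite mul1r diff_scalar => hs.
have [->|wz] := eqVneq w z.
  by rewrite subrr mul0r normr0 realC_ge0 addr_ge0 // -realC_ge0 -normC_real normr_ge0.
rewrite normrM normfV ler_pdivrMr ?normr_gt0 ?subr_eq0 //.
have MC : M%:C%C = `|'d f z 1| + 1 :> C.
  by rewrite [in RHS]normC_real; exact: (rmorphD (real_complex R)).
have -> : M%:C%C * `|w - z| = `|w - z| + `|(w - z) * 'd f z 1|.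
  by rewrite MC normrM mulrDl mul1r addrC; congr (_ + _); rewrite mulrC.
rewrite -{1}(subrK ((w - z) * 'd f z 1) (f w - f z)).
by apply: le_trans (ler_normD _ _) _; rewrite lerD2r.
Qed.

Lemma taylor_rem_bound f k (z : C) (M : R) : cont_border f (- r) r (- r) r ->
  (forall x y, on_border (- r) r (- r) r x y -> `|f (x +i* y)%C| <= M%:C%C) ->
  `|z| <= (r / 2)%:C%C -> `|taylor_rem f k z| <= (32 * M / r ^+ k)%:C%C.
Proof.
move=> hf hM hz; have nul : `|0 : C| < r%:C%C by rewrite normr0 ltcR.
have -> : 32 * M / r ^+ k = 16 * (M * (2 / r ^+ k.+1)) * r.
  by rewrite exprS; field; rewrite ?expf_neq0 ?gt_eqF.
apply: sqint_bound; first exact: cont_border_taylor (half_lt hz) hf.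
move=> x y h; set w : C := (x +i* y)%C.
have rk0 : 0 < r ^+ k by rewrite exprn_gt0.
have r20 : 0 < r / 2 by rewrite divr_gt0.
have w0 : w != 0 by exact: border_neq h nul.
have wz : w - z != 0 by rewrite subr_eq0; exact: border_neq h (half_lt hz).
rewrite normrM (rmorphM (real_complex R)) /=; apply: ler_pM => //; first exact: hM.
have -> : 2 / r ^+ k.+1 = (r ^+ k * (r / 2))^-1.
  by rewrite exprS; field; rewrite ?gt_eqF.
apply: norm_inv_le; first exact: mulr_gt0.
rewrite (rmorphM (real_complex R)) normrM normrX (rmorphXn (real_complex R)) /=.
apply: ler_pM.
- by rewrite exprn_ge0 // realC_ge0 ltW.
- by rewrite realC_ge0 ltW.
- apply: lerXn2r; last exact: border_norm h.
    by rewrite nnegrE realC_ge0 ltW.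
  by rewrite nnegrE.
exact: border_dist h hz.
Qed.

Lemma taylor_rem_expand f (z : C) k : cont_border f (- r) r (- r) r -> `|z| < r%:C%C ->
  (forall j, (j < k)%N -> taylor_rem f j 0 = 0) ->
  taylor_rem f 0 z = z ^+ k * taylor_rem f k z.
Proof.
move=> hf hz; elim: k => [|k IH] h; first by rewrite mul1r.
rewrite IH; last by move=> j jk; apply: h; rewrite ltnS ltnW.
by rewrite taylor_remS // h // add0r mulrA -exprSr.
Qed.

End SquareExpansion.

(** * Zeros along the slices of a holomorphic function *)

Section SliceDichotomy.
Variable R : realType.
Local Notation C := (Cplx R).
Local Notation Re := (@complex.Re R).
Local Notation Im := (@complex.Im R).

Lemma cont_on_bounded (a b : R) (g : R -> C) : a <= b -> cont_on a b g ->
  exists M : R, forall t, a <= t <= b -> `|g t| <= M%:C%C.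
Proof.
move=> ab hg; pose h t := Re `|g t|.
have hc : {within `[a, b], continuous h}.
  apply: continuous_in_subspaceT => t; rewrite inE /= in_itv /= => ht.
  apply: (@continuous_comp _ _ _ (fun t => `|g t| : C) Re); last exact: continuous_Re.
  by apply: (@continuous_comp _ _ _ g (fun z : C => `|z|)); [exact: hg|exact: norm_continuous].
have [c _ hmax] := EVT_max ab hc.
exists (h c) => t ht; rewrite normC_real lecR; apply: hmax; by rewrite in_itv.
Qed.

Lemma cont_border_bounded (a b c d : R) (f : C -> C) : a <= b -> c <= d ->
  cont_border f a b c d ->
  exists M : R, forall x y, on_border a b c d x y -> `|f (x +i* y)%C| <= M%:C%C.
Proof.
move=> ab cd hf.
have [M1 h1] := cont_on_bounded ab (cont_border_h1 cd hf).
have [M2 h2] := cont_on_bounded ab (cont_border_h2 cd hf).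
have [M3 h3] := cont_on_bounded cd (cont_border_v1 ab hf).
have [M4 h4] := cont_on_bounded cd (cont_border_v2 ab hf).
exists (Num.max (Num.max M1 M2) (Num.max M3 M4)) => x y [hx hy h].
case: h => e; rewrite e.
- by apply: le_trans (h3 y hy) _; rewrite lecR !le_max lexx !orbT.
- by apply: le_trans (h4 y hy) _; rewrite lecR !le_max lexx !orbT.
- by apply: le_trans (h1 x hx) _; rewrite lecR !le_max lexx.
- by apply: le_trans (h2 x hx) _; rewrite lecR !le_max lexx !orbT.
Qed.

(** If all Taylor coefficients vanish then the value at z is z^k R_k(z) up to a
    nonzero factor, and this is at most a constant times (|z|/r)^k for every k. *)
Lemma slice_vanish (r : R) (f : C -> C) (z : C) : 0 < r ->
  diff_rect f (- r) r (- r) r -> `|z| < (r / 8)%:C%C ->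
  (forall k, taylor_rem r f k 0 = 0) -> f z = 0.
Proof.
move=> r0 hf hz h0.
have num (q : R) : 0 < q -> q / 8 <= q / 2 by lra.
have z2 : `|z| <= (r / 2)%:C%C.
  by apply: ltW; apply: lt_le_trans hz _; rewrite lecR; exact: num.
have rr : - r <= r by rewrite ge0_cp // ltW.
have cf := cont_rect_border (diff_rect_cont hf).
have [M hM] := cont_border_bounded rr rr cf.
have zr := half_lt r0 z2.
have eqk k : f z * sqint r (fun w => (w - z)^-1) = z ^+ k * taylor_rem r f k z.
  by rewrite -(cauchy_square r0 hf zr); apply: taylor_rem_expand.
suff : f z * sqint r (fun w => (w - z)^-1) = 0.
  by move/eqP; rewrite mulf_eq0 (negbTE (sqint_kernel_neq0 r0 hz)) orbF => /eqP.
apply/eqP; rewrite -normr_le0 normC_real -(rmorph0 (real_complex R)) lecR leNgt.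
set J := f z * _ in eqk *; apply/negP => J0.
have M0 : 0 <= M.
  have b : on_border (- r) r (- r) r r r by split; rewrite ?rr ?lexx //; constructor 2.
  by rewrite -realC_ge0; exact: le_trans (normr_ge0 _) (hM _ _ b).
have Jk k : Re `|J| <= 32 * M * (8^-1) ^+ k.
  rewrite -lecR -normC_real (eqk k) normrM normrX.
  have r8 : 0 <= r / 8 by rewrite divr_ge0 // ltW.
  apply: le_trans (_ : _ <= ((r / 8) ^+ k)%:C%C * (32 * M / r ^+ k)%:C%C) _.
    apply: ler_pM; rewrite ?exprn_ge0 //; last exact: taylor_rem_bound.
    rewrite (rmorphXn (real_complex R)); apply: lerXn2r; last exact: ltW.
      by rewrite nnegrE.
    by rewrite nnegrE realC_ge0.
  rewrite -(rmorphM (real_complex R)) lecR le_eqVlt; apply/orP; left; apply/eqP.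
  by rewrite expr_div_n exprVn; field; rewrite !expf_neq0 // gt_eqF.
have [k hk] : exists k, 32 * M * (8^-1) ^+ k < Re `|J|.
  have /cvgr0Pnorm_lt/(_ _ J0)[k _ /(_ k)] : (fun k => 32 * M * (8^-1) ^+ k) @ \oo --> (0 : R).
    rewrite -[X in _ --> X](mulr0 (32 * M)); apply: cvgM; first exact: cvg_cst.
    by apply: cvg_expr; rewrite ger0_norm ?invf_lt1 ?ltr1n.
  by rewrite /= => /(_ (leqnn _)) h'; exists k; apply: le_lt_trans h'; exact: ler_norm.
by have := le_lt_trans (Jk k) hk; rewrite ltxx.
Qed.

(** F is studied along the complex lines in the direction e; lam is the coordinate
    on these lines, and the projection y - lam y *: e onto {lam = 0} preserves both
    the line and N.  Let k be the least order for which the k-th Taylor coefficient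
    along the lines is not identically zero on {lam = 0}.  Then F is lam^k R_k up to
    a nonzero factor, and R_k, being continuous, is nonzero near any point y1 where
    that coefficient is nonzero. *)
Lemma slice_zeros (V : normedModType C) (F : V -> C) (e : V) (lam : V -> C)
    (N : set V) (r : R) : 0 < r -> continuous lam ->
  (forall v z, lam (v + z *: e) = lam v + z) -> open N ->
  (forall y, N y -> N (y - lam y *: e)) ->
  (forall y, N y -> `|lam y| < (r / 8)%:C%C) ->
  (forall y s t, N y -> - r <= s <= r -> - r <= t <= r ->
     differentiable F (y + (((s +i* t)%C : C) - lam y) *: e)) ->
  (forall y, N y -> F y = 0) \/
  (exists y1, [/\ N y1, lam y1 = 0 & \forall y \near y1, F y = 0 -> lam y = 0]).
Proof.
move=> r0 lamc lamD oN Npi Nlam dF.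
have num (q : R) : 0 < q -> q / 8 <= q / 2 by lra.
have Nlam2 y : N y -> `|lam y| < r%:C%C.
  move=> /Nlam h; apply: half_lt => //; apply: ltW.
  by apply: lt_le_trans h _; rewrite lecR; exact: num.
pose G (y : V) (w : C) := F (y + (w - lam y) *: e).
have GE y : G y (lam y) = F y by rewrite /G subrr scale0r addr0.
have lampi y : lam (y - lam y *: e) = 0 by rewrite -scaleNr lamD subrr.
have Gpi y : G (y - lam y *: e) = G y.
  by apply/funext => w; rewrite /G lampi subr0 scalerBl addrA addrAC.
have dG y : N y -> diff_rect (G y) (- r) r (- r) r.
  move=> Ny s t hs ht.
  apply: (@differentiable_comp C C^o V C^o (fun w => y + (w - lam y) *: e) F); last exact: dF.
  apply: (@differentiableD C C^o V (cst y) (fun w => (w - lam y) *: e)).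
    exact: differentiable_cst.
  apply: (@differentiableZl C C^o V (fun w => w - lam y) e).
  by apply: (@differentiableB C C^o C^o id (cst (lam y))); exact: ex_diff.
have cG y (Ny : N y) := cont_rect_border (diff_rect_cont (dG y Ny)).
pose P k := exists y, [/\ N y, lam y = 0 & taylor_rem r (G y) k 0 != 0].
have [hall|hex] := pselect (forall k, ~ P k).
  left=> y Ny; rewrite -GE; apply: (slice_vanish r0 (dG y Ny) (Nlam y Ny)) => k.
  apply/eqP; apply/negPn/negP => h; apply: (hall k).
  by exists (y - lam y *: e); rewrite Gpi; split => //; exact: Npi.
right.
have hexb : exists k, `[< P k >].
  by apply: contrapT => h; apply: hex => k Pk; apply: h; exists k; apply/asboolP.
have [k /asboolP[y1 [Ny1 l1 nz]] kmin] := ex_minnP hexb.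
have low j y : (j < k)%N -> N y -> taylor_rem r (G y) j 0 = 0.
  move=> jk Ny; apply/eqP; apply/negPn/negP => h.
  have : (k <= j)%N.
    apply: kmin; apply/asboolP; exists (y - lam y *: e); rewrite Gpi.
    by split => //; exact: Npi.
  by rewrite leqNgt jk.
exists y1; split => //.
have rr : - r <= r by rewrite ge0_cp // ltW.
have Tc : {for y1, continuous (fun y => taylor_rem r (G y) k (lam y))}.
  rewrite /taylor_rem /sqint.
  apply: (@rectint_continuous R V (fun y w => G y w * (w ^+ k * (w - lam y))^-1)) => //.
    move=> s t hst; set w : C := (s +i* t)%C.
    have w0 : w != 0 by apply: border_neq hst _; rewrite ?normr0 ?realC_gt0.
    have w1 : w - lam y1 != 0 by rewrite l1 subr0.
    apply: (@continuousM_C R _ (y1, w) (fun p : V * C => G p.1 p.2)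
      (fun p : V * C => (p.2 ^+ k * (p.2 - lam p.1))^-1)).
      apply: (@continuous_comp _ _ _ (fun p : V * C => p.1 + (p.2 - lam p.1) *: e) F).
        apply: (@continuousD C V _ fst (fun p : V * C => (p.2 - lam p.1) *: e) (y1, w)).
          exact: cvg_fst.
        apply: (@continuousZ C V _ (fun p : V * C => p.2 - lam p.1) (cst e) (y1, w)); last exact: cst_continuous.
        apply: (@continuousB_C R _ (y1, w) snd (fun p : V * C => lam p.1)); first exact: cvg_snd.
        apply: (@continuous_comp _ _ _ (@fst V C) lam); first exact: cvg_fst.
        exact: lamc.
      by apply: differentiable_continuous; apply: dF; case: hst.
    apply: (@continuousV_C R _ (y1, w) (fun p : V * C => p.2 ^+ k * (p.2 - lam p.1))); last first.
      by rewrite /= mulf_neq0 ?expf_neq0.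
    apply: (@continuousM_C R _ (y1, w) (fun p : V * C => p.2 ^+ k) (fun p : V * C => p.2 - lam p.1)).
      by apply: (@continuousX_C R _ (y1, w) snd); exact: cvg_snd.
    apply: (@continuousB_C R _ (y1, w) snd (fun p : V * C => lam p.1)); first exact: cvg_snd.
    apply: (@continuous_comp _ _ _ (@fst V C) lam); first exact: cvg_fst.
    exact: lamc.
  have : nbhs y1 N by exact: open_nbhs_nbhs.
  apply: filterS => y Ny; apply: cont_border_taylor => //; [exact: Nlam2|exact: cG].
have Tnz : \forall y \near y1, taylor_rem r (G y) k (lam y) != 0.
  apply: (@cvgr_neq0 C C^o V (nbhs y1) (nbhs_filter y1)
    (fun y => taylor_rem r (G y) k (lam y)) _ Tc).
  by rewrite l1.
have : nbhs y1 N by exact: open_nbhs_nbhs.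
move: Tnz; apply: filterS2 => y hT Ny Fy.
have := @taylor_rem_expand R r r0 (G y) (lam y) k (cG y Ny) (Nlam2 y Ny)
  (fun j jk => low j y jk Ny).
rewrite (cauchy_square r0 (dG y Ny) (Nlam2 y Ny)) GE Fy mul0r => /esym/eqP.
by rewrite mulf_eq0 (negbTE hT) orbF expf_eq0 => /andP[_ /eqP].
Qed.

End SliceDichotomy.

(** * Charts and sheets *)

Section Sheets.
Variable R : realType.
Local Notation C := (Cplx R).

(** The part of the definition of a regular point that does not mention the set. *)
Definition chart (n : nat) (V W : set 'rV[C]_n) (phi psi : 'rV[C]_n -> 'rV[C]_n) :=
  [/\ open V /\ open W, [/\ holomorphic_on V phi, holomorphic_on W psi,
      (forall x, V x -> W (phi x)) & (forall y, W y -> V (psi y))],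
      (forall x, V x -> psi (phi x) = x) & (forall y, W y -> phi (psi y) = y)].

Lemma open_preimage_on (S T : topologicalType) (V : set S) (B : set T) (f : S -> T) :
  open V -> open B -> (forall x, V x -> {for x, continuous f}) ->
  open (V `&` f @^-1` B).
Proof.
move=> oV oB hf; rewrite openE => x [Vx Bx]; apply: filterI.
  exact: open_nbhs_nbhs.
by apply: (hf x Vx); exact: open_nbhs_nbhs.
Qed.

Lemma holomorphic_continuous n m (U : set 'rV[C]_n) (f : 'rV[C]_n -> 'rV[C]_m) x :
  holomorphic_on U f -> U x -> {for x, continuous f}.
Proof. by move=> hf Ux; apply: differentiable_continuous; exact: hf. Qed.

Lemma chart_restrict n (V W O : set 'rV[C]_n) phi psi : chart V W phi psi -> open O ->
  chart (V `&` O) (W `&` psi @^-1` O) phi psi.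
Proof.
move=> [[oV oW] [hphi hpsi VW WV] k1 k2] oO; split.
- split; first exact: openI.
  by apply: open_preimage_on => // y; exact: holomorphic_continuous.
- split.
  + by move=> x [Vx _]; exact: hphi.
  + by move=> x [Wx _]; exact: hpsi.
  + by move=> x [Vx Ox]; split; [exact: VW|rewrite /preimage /= k1].
  + by move=> y [Wy Oy]; split => //; exact: WV.
- by move=> x [Vx _]; exact: k1.
- by move=> y [Wy _]; exact: k2.
Qed.

Lemma chart_id n (O : set 'rV[C]_n) : open O -> chart O O id id.
Proof.
move=> oO; split => //; split => // x _; exact: ex_diff.
Qed.

Lemma regular_pointE n (A : set 'rV[C]_n) d p : regular_point A d p <->
  [/\ A p, (d <= n)%N & exists V W phi psi, [/\ chart V W phi psi, V p &
    forall x, V x -> (A x <-> forall i : 'I_n, (d <= i)%N -> phi x 0 i = 0)]].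
Proof.
split=> -[Ap dn].
  by move=> [V [W [phi [psi [[? ? ?] [? ? ? ?] ? ? h]]]]]; split=> //; exists V, W, phi, psi.
by move=> [V [W [phi [psi [[[? ?] [? ? ? ?] ? ?] ? h]]]]]; split=> //; exists V, W, phi, psi.
Qed.

(** A nonempty piece of smooth hypersurface, in a form that survives shrinking.
    The last coordinate may take any constant value on it, so that no translation
    of charts is needed when a sheet is restricted. *)
Definition sheet (n : nat) (S : set 'rV[C]_n.+1) :=
  exists V W phi psi a, [/\ chart V W phi psi,
    S = V `&` [set x | phi x 0 ord_max = a] & S !=set0].

Lemma sheet_restrict n (S O : set 'rV[C]_n.+1) : sheet S -> open O ->
  S `&` O !=set0 -> sheet (S `&` O).
Proof.
move=> [V [W [phi [psi [a [ch -> _]]]]]] oO ne.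
exists (V `&` O), (W `&` psi @^-1` O), phi, psi, a; split => //.
  exact: chart_restrict.
by rewrite setIAC.
Qed.

Lemma open_has_sheet n (O : set 'rV[C]_n.+1) : open O -> O !=set0 ->
  exists2 S, sheet S & S `<=` O.
Proof.
move=> oO [x Ox]; exists (O `&` [set y | y 0 ord_max = x 0 ord_max]); last first.
  by move=> y [].
exists O, O, id, id, (x 0 ord_max); split => //; first exact: chart_id.
by exists x.
Qed.

(** Straighten the sheet by its chart and apply [slice_zeros] in the direction of
    the last coordinate. *)
Lemma sheet_zeros n (S U : set 'rV[C]_n.+1) (f : 'rV[C]_n.+1 -> C) :
  sheet S -> open U -> S `<=` U -> (forall x, U x -> differentiable f x) ->
  (forall x, S x -> f x = 0) ->
  (exists O, [/\ open O, O `<=` U, S `&` O !=set0 & forall x, O x -> f x = 0]) \/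
  (exists O, [/\ open O, O `<=` U, S `&` O !=set0 & forall x, O x -> f x = 0 -> S x]).
Proof.
move=> [V [W [phi [psi [a [ch eS [p Sp]]]]]]] oU SU df fS.
have {ch} := chart_restrict ch oU; set V' := V `&` U; set W' := _ `&` _ => ch.
have VU : V' `<=` U by move=> x [].
have {}eS : S = V' `&` [set x | phi x 0 ord_max = a].
  by rewrite /V' setIAC -eS; apply/seteqP; split => [x Sx|x []//]; split => //; exact: SU.
have [Vp ap] : V' p /\ phi p 0 ord_max = a by move: Sp; rewrite eS.
move: V' W' ch VU eS Vp => {}V {}W [[oV oW] [hphi hpsi VW WV] k1 k2] VU eS Vp.
pose y0 := phi p; have Wy0 : W y0 by exact: VW.
have /nbhs_realdist[rho rho0 hrho] : nbhs y0 W by exact: open_nbhs_nbhs.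
pose e : 'rV[C]_n.+1 := delta_mx 0 ord_max.
pose lam (y : 'rV[C]_n.+1) : C := y 0 ord_max - a.
have [E E0 eE] := nonneg_realC (normr_ge0 e).
(* Half-side of the squares in the slices: moving by at most 2 r e from a point
   within rho / 4 of y0 stays within rho of y0. *)
pose r := rho / (8 * (E + 1)).
have r0 : 0 < r by rewrite divr_gt0 // mulr_gt0 // ltr_wpDl.
have lamc : continuous lam.
  move=> y; apply: (@continuousB_C R _ y (fun y : 'rV[C]_n.+1 => y 0 ord_max) (fun=> a)).
    exact: coord_continuous.
  exact: cst_continuous.
have lamD v z : lam (v + z *: e) = lam v + z.
  by rewrite /lam !mxE !eqxx mulr1 addrAC.
pose pr (y : 'rV[C]_n.+1) : 'rV[C]_n.+1 := y - lam y *: e - y0.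
have prc : continuous pr.
  move=> y.
  have c1 : {for y, continuous (fun y => lam y *: e)}.
    by apply: (@continuousZ C _ _ lam (fun=> e)); [exact: lamc|exact: cst_continuous].
  have c2 : {for y, continuous (fun y : 'rV[C]_n.+1 => y - lam y *: e)}.
    exact: (@continuousB C 'rV[C]_n.+1 _ id (fun y => lam y *: e) y (fun A h => h) c1).
  exact: (@continuousB C 'rV[C]_n.+1 _ _ (fun=> y0) y c2 (@cst_continuous _ _ y0 y)).
(* N is defined through the projection onto {lam = 0}, which it must be stable
   under. *)
pose N := pr @^-1` (ball 0 (rho / 4)%:C%C) `&` lam @^-1` (ball 0 (r / 8)%:C%C).
have oN : open N.
  apply: openI; apply: open_comp; try exact: ball_open.
    by move=> y _; exact: prc.
  by move=> y _; exact: lamc.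
have NE y : N y <-> `|pr y| < (rho / 4)%:C%C /\ `|lam y| < (r / 8)%:C%C.
  by rewrite /N /= -!ball_normE /ball_ /= !sub0r !normrN.
have lampi y : lam (y - lam y *: e) = 0 by rewrite -scaleNr lamD subrr.
have Npi y : N y -> N (y - lam y *: e).
  move=> /NE[h1 h2]; apply/NE; rewrite /pr !lampi scale0r subr0 normr0 realC_gt0.
  by split => //; rewrite divr_gt0.
have Nlam y : N y -> `|lam y| < (r / 8)%:C%C by case/NE.
have num : rho / 4 + 2 * (r * E) < rho.
  have h : r * E <= rho / 8.
    rewrite /r -mulrA -[leRHS]mulr1; have -> : rho * ((8 * (E + 1))^-1 * E) = rho / 8 * (E / (E + 1)).
      by field; rewrite gt_eqF // ltr_wpDl.
    by apply: ler_wpM2l; [rewrite divr_ge0 // ltW|rewrite ler_pdivrMr ?mul1r ?ltr_wpDl // lerDl].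
  by clear -h rho0; lra.
have Wslice y s t : N y -> - r <= s <= r -> - r <= t <= r ->
    W (y + (((s +i* t)%C : C) - lam y) *: e).
  move=> /NE[h1 h2] hs ht; apply: hrho; set w : C := (s +i* t)%C.
  have -> : y + (w - lam y) *: e - y0 = pr y + w *: e.
    by apply/rowP => i; rewrite /pr !mxE; ring.
  apply: le_lt_trans (ler_normD _ _) _; rewrite normrZ eE.
  have hw : `|w| <= (2 * r)%:C%C.
    apply: le_trans (normC_le_ReIm _) _; rewrite lecR /= mulr_natl mulr2n.
    by apply: lerD; rewrite ler_norml.
  apply: le_lt_trans (_ : _ <= (rho / 4 + 2 * (r * E))%:C%C) _; last by rewrite ltcR.
  rewrite (rmorphD (real_complex R)) /=; apply: lerD; first exact: ltW.
  by rewrite mulrA (rmorphM (real_complex R)) /=; apply: ler_wpM2r; rewrite ?realC_ge0.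
have dF y s t : N y -> - r <= s <= r -> - r <= t <= r ->
    differentiable (f \o psi) (y + (((s +i* t)%C : C) - lam y) *: e).
  move=> Ny hs ht; have Wy := Wslice y s t Ny hs ht.
  by apply: differentiable_comp; [exact: hpsi|apply: df; apply: VU; exact: WV].
have Ny0 : N y0.
  have l0 : lam y0 = 0 by rewrite /lam ap subrr.
  apply/NE; rewrite /pr l0 scale0r subr0 subrr normr0 realC_gt0.
  by rewrite normr0 realC_gt0; split; rewrite divr_gt0.
have cphi x : V x -> {for x, continuous phi} by exact: holomorphic_continuous.
have [hall|[y1 [Ny1 l1 hnear]]] := slice_zeros r0 lamc lamD oN Npi Nlam dF.
  left; exists (V `&` phi @^-1` N); split.
  - exact: open_preimage_on.
  - by move=> x [/VU].
  - by exists p.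
  - by move=> x [Vx Nx]; have := hall _ Nx; rewrite /= k1.
right; exists (V `&` phi @^-1` (interior [set y | f (psi y) = 0 -> lam y = 0])); split.
- by apply: open_preimage_on => //; exact: open_interior.
- by move=> x [/VU].
- have Wy1 : W y1.
    have r00 : - r <= 0 <= r by rewrite oppr_le0 (ltW r0).
    have := Wslice y1 0 0 Ny1 r00 r00.
    by rewrite (_ : (0 +i* 0)%C = 0) // l1 subr0 scale0r addr0.
  exists (psi y1); rewrite eS; split; split; try exact: WV.
  + by rewrite /= k2 //; apply/eqP; rewrite -subr_eq0; apply/eqP.
  + by rewrite /= k2.
- move=> x [Vx /interior_subset /=]; rewrite k1 // => h fx; rewrite eS; split => //=.
  by apply/eqP; rewrite -subr_eq0; apply/eqP; exact: h.
Qed.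

End Sheets.

(** * Reducedness in terms of sheets *)

Section Reducedness.
Variable R : realType.
Local Notation C := (Cplx R).

Lemma regular_point_has_sheet n (A : set 'rV[C]_n.+1) d p : regular_point A d p ->
  (n <= d)%N -> exists S, [/\ sheet S, S p & S `<=` A].
Proof.
move=> /regular_pointE[Ap dn [V [W [phi [psi [ch Vp h]]]]]] nd.
exists (V `&` [set x | phi x 0 ord_max = phi p 0 ord_max]); split => //.
  by exists V, W, phi, psi, (phi p 0 ord_max); split => //; exists p.
move=> x [Vx ex]; apply/(h x Vx) => i di.
have ei : i = ord_max.
  apply/val_inj => /=; apply/eqP; rewrite eqn_leq -ltnS ltn_ord /=.
  exact: leq_trans nd di.
by rewrite ei ex; have /(h p Vp) := Ap; apply; rewrite -ei.
Qed.

Lemma differentiable_shift n (v : 'rV[C]_n) x : differentiable (fun y : 'rV[C]_n => y + v) x.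
Proof.
apply: (@differentiableD C 'rV[C]_n 'rV[C]_n id (cst v)); first exact: ex_diff.
exact: differentiable_cst.
Qed.

(** In the definition of a regular point the last coordinate must vanish, hence the
    translation by the value it takes on the sheet. *)
Lemma sheet_regular_point n (A S O : set 'rV[C]_n.+1) : sheet S -> open O ->
  (forall x, O x -> (A x <-> S x)) -> forall p, (S `&` O) p -> regular_point A n p.
Proof.
move=> [V [W [phi [psi [a [ch eS _]]]]]] oO hAS p [Sp Op].
have Vp : (V `&` O) p by split => //; move: Sp; rewrite eS => -[].
apply/regular_pointE; split => //; first exact/(hAS p Op).
have [[oV oW] [hphi hpsi VW WV] k1 k2] := chart_restrict ch oO.
(* Translation bringing the value a of the last coordinate to 0. *)
pose v : 'rV[C]_n.+1 := a *: delta_mx 0 ord_max.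
have vm : v 0 ord_max = a by rewrite /v !mxE !eqxx mulr1.
set V' := V `&` O in oV hphi VW WV k1 Vp *; set W' := _ `&` _ in oW hpsi VW WV k2.
exists V', ((fun y => y + v) @^-1` W'), (fun x => phi x - v), (fun y => psi (y + v)).
split; [|exact: Vp|].
  split; [split; first exact: oV| split | |].
  - apply: open_comp; last exact: oW.
    move=> y _; apply: differentiable_continuous.
    exact: differentiable_shift.
  - move=> x Vx; apply: (@differentiable_comp C _ _ _ phi (fun y => y + - v)).
      exact: hphi.
    exact: differentiable_shift.
  - move=> y Wy; apply: (@differentiable_comp C _ _ _ (fun y => y + v) psi).
      exact: differentiable_shift.
    exact: hpsi.
  - by move=> x Vx; rewrite /preimage /= subrK; exact: VW.
  - by move=> y Wy; exact: WV.
  - by move=> x Vx; rewrite /= subrK k1.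
  - by move=> y Wy; rewrite /= k2 // addrK.
move=> x [Vx Ox]; split.
  move=> /(hAS x Ox); rewrite eS => -[_ /= ex] i ni.
  have -> : i = ord_max.
    by apply/val_inj => /=; apply/eqP; rewrite eqn_leq -ltnS ltn_ord.
  by rewrite !mxE ex !eqxx mulr1 subrr.
move=> h; apply/(hAS x Ox); rewrite eS; split => //=.
have := h ord_max (leqnn _); rewrite mxE [(- v) _ _]mxE vm => /eqP.
by rewrite subr_eq0 => /eqP.
Qed.

Lemma open_regular_point n (A O : set 'rV[C]_n) p : open O -> O p -> O `<=` A ->
  regular_point A n p.
Proof.
move=> oO Op OA; apply/regular_pointE; split => //; first exact: OA.
exists O, O, id, id; split => //; first exact: chart_id.
by move=> x Ox; split => [_ i|_]; [rewrite leqNgt ltn_ord|exact: OA].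
Qed.

(** Path-connectedness, in the form used to show that a chart of Z around p lies in
    a single component of the regular locus. *)
Lemma path_component (T : topologicalType) (A : set T) (g : R -> T) :
  (forall t, 0 <= t <= 1 -> {for t, continuous g}) ->
  (forall t, 0 <= t <= 1 -> A (g t)) -> connected_component A (g 0) (g 1).
Proof.
move=> cg Ag; exists (g @` `[0, 1]%classic).
  split.
  - by exists 0 => //=; rewrite in_itv /= lexx ler01.
  - by move=> _ [t /= + <-]; rewrite in_itv /= => /Ag.
  - apply: connected_continuous_connected; first exact: segment_connected.
    apply: continuous_in_subspaceT => t; rewrite inE /= in_itv /=; exact: cg.
by exists 1 => //=; rewrite in_itv /= lexx ler01.
Qed.

(** Near p the regular locus of Z is the image of a piece of a linear subspace cut
    out by a ball, hence path-connected; so the component through p is all of Z near p,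
    and its closure adds nothing because Z is closed in U. *)
Lemma component_regular_point n (Z U : set 'rV[C]_n) d p : Z `<=` U ->
  closure Z `&` U `<=` Z -> regular_point Z d p ->
  regular_point (closure (connected_component (regular_locus Z) p) `&` U) d p.
Proof.
move=> ZU clZ /regular_pointE[Zp dn [V [W [phi [psi [ch Vp h]]]]]].
set K := connected_component _ _.
have KZ : K `<=` Z.
  by move=> x /connected_component_sub [e /regular_pointE[]].
have YZ : closure K `&` U `<=` Z.
  by move=> x [hx Ux]; apply: clZ; split => //; exact: closure_subset hx.
have regV x : V x -> Z x -> regular_locus Z x.
  move=> Vx Zx; exists d; apply/regular_pointE; split => //.
  by exists V, W, phi, psi.
have [[oV oW] [hphi hpsi VW WV] k1 k2] := ch.
have Wy0 : W (phi p) by exact: VW.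
have /nbhs_realdist[rho rho0 hrho] : nbhs (phi p) W by exact: open_nbhs_nbhs.
pose O := V `&` phi @^-1` (ball (phi p) rho%:C%C).
have oO : open O.
  have oB : open (ball (phi p) rho%:C%C) by apply: ball_open; rewrite realC_gt0.
  by apply: open_preimage_on oV oB _ => x; exact: holomorphic_continuous.
have Op : O p.
  by split => //=; apply: ballxx; rewrite realC_gt0.
have ZO x : O x -> Z x -> K x.
  move=> [Vx /= Bx] Zx; pose g (t : R) := psi (phi p + t%:C%C *: (phi x - phi p)).
  have pE : g 0 = p by rewrite /g scale0r addr0 k1.
  have xE : g 1 = x by rewrite /g scale1r addrC subrK k1.
  have Wg (t : R) : 0 <= t <= 1 -> W (phi p + t%:C%C *: (phi x - phi p)).
    move=> /andP[t0 t1]; apply: hrho; rewrite addrAC subrr add0r normrZ normCR ger0_norm //.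
    move: Bx; rewrite -ball_normE /ball_ /= distrC => /(le_lt_trans _); apply.
    apply: ler_piMl; first exact: normr_ge0.
    by rewrite -[X in _ <= X](rmorph1 (real_complex R)) lecR.
  rewrite /K -pE -xE; apply: path_component => t ht.
    apply: (@continuous_comp _ _ _ (fun t : R => phi p + t%:C%C *: (phi x - phi p)) psi).
      have c1 : {for t, continuous (fun t : R => (t%:C%C : C) *: (phi x - phi p))}.
        apply: (@continuousZ C _ _ (fun t : R => t%:C%C : C) (fun=> phi x - phi p)).
          exact: continuous_real_complex.
        exact: cst_continuous.
      exact: (@continuousD C 'rV[C]_n _ (fun=> phi p) _ t (@cst_continuous _ _ (phi p) t) c1).
    exact: holomorphic_continuous hpsi (Wg t ht).
  apply: regV; first exact: WV (Wg t ht).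
  apply/h; first exact: WV (Wg t ht).
  move=> i di; rewrite /g k2; last exact: Wg.
  have zx := (h x Vx).1 Zx i di; have zp := (h p Vp).1 Zp i di.
  by rewrite !mxE zx zp subrr mulr0 addr0.
apply/regular_pointE; split => //.
  by split; [apply: subset_closure; exact: ZO|exact: ZU].
have ch' := chart_restrict ch oO.
exists (V `&` O), (W `&` psi @^-1` O), phi, psi; split; [exact: ch'|by split|].
move=> x [Vx Ox]; split.
  by move=> Yx; apply/(h x Vx); exact: YZ.
move=> hx; have Zx : Z x by apply/(h x Vx).
by split; [apply: subset_closure; exact: ZO|exact: ZU].
Qed.

Lemma closed_zero_set n m (U : set 'rV[C]_n) (f : 'rV[C]_n -> 'rV[C]_m) :
  holomorphic_on U f -> closure (f @^-1` [set 0] `&` U) `&` U `<=` f @^-1` [set 0] `&` U.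
Proof.
move=> hf x [clx Ux]; split => //=; apply/eqP; apply/negPn/negP => nz.
have cf := holomorphic_continuous hf Ux.
have hn := @cvgr_neq0 C _ _ (nbhs x) (nbhs_filter x) f _ cf nz.
by have [y [[/= y0 _]]] := clx _ hn; rewrite /= y0 eqxx.
Qed.

(** Were there a sheet S in the zero set, either some coefficient of w would have its
    zero set equal to S near a point of S, which is then a regular point of
    dimension n, or each coefficient would vanish on an open set meeting S; shrinking
    S to these open sets one after the other, w would vanish on an open set.  Either
    way the component through that regular point would have codimension at most 1. *)
Lemma reduced_no_sheet n (U : set 'rV[C]_n.+1) (w : 'rV[C]_n.+1 -> 'rV[C]_n.+1) :
  open U -> holomorphic_on U w -> reduced_on U w ->
  forall S, sheet S -> ~ (S `<=` sing w `&` U).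
Proof.
move=> oU hw red.
set A := sing w `&` U.
have AU : A `<=` U by move=> x [].
have clA : closure A `&` U `<=` A by exact: closed_zero_set.
have noreg d p : regular_point A d p -> (d < n)%N.
  move=> rp; rewrite ltnNge; apply/negP => nd.
  have rY := component_regular_point AU clA rp.
  have [|c [e [ec _ emax]] c2] := red (closure (connected_component (regular_locus A) p) `&` U).
    by exists p => //; exists d.
  have de := emax _ _ rY.
  have : (d + 2 <= n.+1)%N by rewrite -ec; exact: leq_add.
  by rewrite addn2 ltnS ltnNge nd.
move=> S hS SA; have SU : S `<=` U by move=> x /SA[].
have noopen O : open O -> O !=set0 -> ~ (O `<=` A).
  move=> oO [p Op] OA; have := noreg _ _ (open_regular_point oO Op OA).
  by rewrite ltnNge leqnSn.
pose f i x := w x 0 i.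
have df i x : U x -> differentiable (f i) x.
  move=> Ux; apply: (@differentiable_comp C _ _ _ w (fun v : 'rV[C]_n.+1 => v 0 i)).
    exact: hw.
  exact: differentiable_coord.
have fS i x : S x -> f i x = 0 by move=> /SA[wx _]; rewrite /f wx mxE.
have good i : (exists O, [/\ open O, O `<=` U, S `&` O !=set0 & forall x, O x -> f i x = 0 -> S x]) -> False.
  move=> [D [oD DU [s [Ss Ds]] h]].
  have hAS x : D x -> (A x <-> S x).
    move=> Dx; split; last exact: SA.
    by move=> [wx _]; apply: h => //; rewrite /f wx mxE.
  by have := noreg _ _ (sheet_regular_point hS oD hAS (conj Ss Ds)); rewrite ltnn.
(* After k steps the first k coefficients of w vanish on an open set meeting S. *)
have step (k : nat) : (k <= n.+1)%N -> exists O, [/\ open O, O `<=` U, S `&` O !=set0 &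
    forall x (i : 'I_n.+1), O x -> (i < k)%N -> f i x = 0].
  elim: k => [_|k IH kn].
    by exists U; split => //; have [V [W [phi [psi [a [_ _ [p Sp]]]]]]] := hS; exists p; split => //; exact: SU.
  have [ O [oO OU ne hO]] := IH (ltnW kn).
  have SO : sheet (S `&` O) by exact: sheet_restrict.
  pose j := Ordinal kn.
  have h1 : S `&` O `<=` O by move=> x [].
  have h2 x : O x -> differentiable (f j) x by move=> /OU; exact: df.
  have h3 x : (S `&` O) x -> f j x = 0 by move=> [Sx _]; exact: fS.
  have [[D [oD DO [x [[Sx _] Dx]] h]]|[D [oD DO [x [[Sx Ox] Dx]] h]]] :=
    sheet_zeros SO oO h1 h2 h3.
  - exists D; split => //; [by move=> y /DO /OU|by exists x|].
    move=> y i Dy; rewrite ltnS leq_eqVlt => /orP[/eqP ik|ik]; last exact: hO (DO _ Dy) ik.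
    by have -> : i = j by [apply/val_inj]; exact: h.
  - case: (good j); exists D; split => //; [by move=> y /DO /OU|by exists x|].
    by move=> y Dy fy; case: (h y Dy fy).
have [ O [oO OU [p [_ Op]] hO]] := step n.+1 (leqnn _).
apply: (noopen O) => //; first by exists p.
by move=> x Ox; split; [apply/rowP => i; rewrite mxE; exact: hO|exact: OU].
Qed.

(** A component has a regular point of some dimension by
    [component_regular_point], and a regular point of dimension at least n would
    give a sheet. *)
Lemma no_sheet_reduced n (U : set 'rV[C]_n.+1) (w : 'rV[C]_n.+1 -> 'rV[C]_n.+1) :
  open U -> holomorphic_on U w ->
  (forall S, sheet S -> ~ (S `<=` sing w `&` U)) -> reduced_on U w.
Proof.
move=> oU hw noS Y [p [d rp] eY]; set A := sing w `&` U in rp eY.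
have AU : A `<=` U by move=> x [].
have clA : closure A `&` U `<=` A by exact: closed_zero_set.
have := component_regular_point AU clA rp; rewrite -eY => rY.
have YA : Y `<=` A.
  rewrite eY => x [hx Ux]; apply: clA; split => //; apply: closure_subset hx.
  by move=> y /connected_component_sub [e /regular_pointE[]].
have small e q : regular_point Y e q -> (e < n)%N.
  move=> rq; rewrite ltnNge; apply/negP => ne.
  have [S [hS _ SY]] := regular_point_has_sheet rq ne.
  by apply: (noS S hS) => x /SY /YA.
have hex : exists e, `[< exists q, regular_point Y e q >].
  by exists d; apply/asboolP; exists p.
have hub e : `[< exists q, regular_point Y e q >] -> (e <= n)%N.
  by move=> /asboolP[q /small /ltnW].
have [e /asboolP[q rq] emax] := ex_maxnP hex hub.
have en := small _ _ rq.
exists (n.+1 - e)%N; last by rewrite subSn ?(ltnW en) // ltnS subn_gt0.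
exists e; split.
- by rewrite subnKC // (leq_trans (ltnW en)).
- by exists q.
- by move=> q' e' rq'; apply: emax; apply/asboolP; exists q'.
Qed.

End Reducedness.

(** * Generic parameters *)

Section Genericity.
Variable R : realType.
Local Notation C := (Cplx R).

Lemma row_norm_lt n (x : 'rV[C]_n) (e : R) : 0 < e ->
  (forall i, `|x 0 i| < e%:C%C) -> `|x| < e%:C%C.
Proof.
move=> e0 h; have [->|x0] := eqVneq x 0; first by rewrite normr0 realC_gt0.
have /mx_norm_neq0[[i j] /= xE] : mx_norm x != 0 by rewrite -[mx_norm x]/(`|x|) normr_eq0.
by rewrite -[`|x|]/(mx_norm x) xE ord1.
Qed.

Definition rat_point n (q : 'rV[rat * rat]_n) : 'rV[C]_n :=
  \row_i ((ratr (q 0 i).1 : R) +i* ratr (q 0 i).2)%C.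

(** A countable basis of the topology: rational centres, radii 1/(k+1). *)
Definition rat_ball n (b : 'rV[rat * rat]_n * nat) : set 'rV[C]_n :=
  [set x | `|x - rat_point b.1| < (b.2.+1%:R^-1)%:C%C].

Lemma rat_ball_basis n (O : set 'rV[C]_n) x : open O -> O x ->
  exists b, rat_ball b x /\ rat_ball b `<=` O.
Proof.
move=> oO Ox; have /nbhs_realdist[rho rho0 hrho] : nbhs x O by exact: open_nbhs_nbhs.
have [k hk] : exists k : nat, k.+1%:R^-1 < rho / 2.
  have := @near_infty_natSinv_lt R (PosNum (divr_gt0 rho0 (@ltr0Sn R 1))).
  by case=> k _ /(_ k (leqnn k)) /= h; exists k.
pose d : R := k.+1%:R^-1 / 2.
have d0 : 0 < d by rewrite divr_gt0 // invr_gt0.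
have approx (t : R) : exists q : rat, `|t - ratr q| < d.
  have /rat_in_itvoo[q] : t - d < t + d by rewrite ltrD2l gtrN.
  rewrite in_itv /= => /andP[h1 h2]; exists q; rewrite ltr_norml.
  by apply/andP; split; lra.
have approx2 (z : C) : exists q : rat * rat,
    `|z - ((ratr q.1 : R) +i* ratr q.2)%C| < (k.+1%:R^-1)%:C%C.
  have [q1 h1] := approx (complex.Re z); have [q2 h2] := approx (complex.Im z).
  exists (q1, q2); apply: le_lt_trans (normC_le_ReIm _) _; rewrite ltcR.
  case: z h1 h2 => a b /= h1 h2; apply: lt_le_trans (ltrD h1 h2) _.
  by rewrite -splitr.
have [q hq] := choice (fun i => approx2 (x 0 i)).
exists (\row_i q i, k); split.
  apply: row_norm_lt; first by rewrite invr_gt0.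
  by move=> i; rewrite !mxE; exact: hq.
move=> y hy; apply: hrho; rewrite -(subrKA (rat_point (\row_i q i))).
apply: le_lt_trans (ler_normD _ _) _.
apply: (@lt_trans _ _ ((k.+1%:R^-1)%:C%C + (k.+1%:R^-1)%:C%C)).
  apply: ltrD; first exact: hy.
  rewrite distrC; apply: row_norm_lt; first by rewrite invr_gt0.
  by move=> i; rewrite !mxE; exact: hq.
by rewrite -(rmorphD (real_complex R)) ltcR [ltRHS]splitr; exact: ltrD.
Qed.

(** A countable union of finite sets has Lebesgue measure zero. *)
Lemma avoid_countable (I : countType) (Bad : I -> set R) (s : seq R) :
  (forall i, finite_set (Bad i)) -> exists t, t \notin s /\ forall i, ~ Bad i t.
Proof.
move=> fin; apply: contrapT => hn.
pose F (o : option I) := if o is Some i then Bad i else [set` s].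
have cov : [set: R] `<=` \bigcup_o F o.
  move=> t _; apply: contrapT => ht; apply: hn; exists t; split.
    by apply/negP => ts; apply: ht; exists None.
  by move=> i hi; apply: ht; exists (Some i).
have cnt : countable [set: R].
  apply: sub_countable (subset_card_le cov) _.
  apply: bigcup_countable; first exact: countableP.
  by move=> [i|] _; apply: finite_set_countable => //=; exact: finite_seq.
have := countable_lebesgue_measure0 (sub_countable (subset_card_le (@subsetT _ `[(0:R), 1]%classic)) cnt).
rewrite lebesgue_measure_itv /= lte_fin ltr01 oppr0 adde0 => /eqP.
by rewrite eqe oner_eq0.
Qed.

(** A point of the moment curve; pairing with it evaluates a polynomial at t, so a
    nonzero vector is orthogonal to finitely many such points only. *)
Definition moment m (t : R) : 'rV[C]_m := \row_i (t%:C%C ^+ i).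

Lemma finite_moment_zeros m (v : 'rV[C]_m.+1) : v != 0 ->
  finite_set [set t : R | pairing v (moment m.+1 t) = 0].
Proof.
move=> v0; pose p : {poly C} := \poly_(i < m.+1) v 0 (inord i).
have pE t : p.[t%:C%C] = pairing v (moment m.+1 t).
  by rewrite horner_poly; apply: eq_bigr => i _; rewrite inord_val mxE.
have p0 : p != 0.
  apply: contra v0 => /eqP p0; apply/eqP/rowP => i; rewrite mxE.
  by have := coef_poly m.+1 (fun i => v 0 (inord i)) i; rewrite -/p p0 coef0 ltn_ord inord_val.
have [r pr] := closed_field_poly_normal p.
apply: (@sub_finite_set _ _ ((fun t : R => t%:C%C : C) @^-1` [set` r])).
  move=> t /=; rewrite -pE => /rootP; rewrite pr rootZ ?lead_coef_eq0 //.
  by rewrite root_prod_XsubC.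
apply: finite_preimage; last exact: finite_seq.
by move=> x y _ _ [].
Qed.

(** If w(moment t) vanishes on an open set, it vanishes on a rational ball containing
    a point where w is nonzero, and each ball does this for finitely many t. *)
Lemma generic_no_open_zero m n (U : set 'rV[C]_n) (w : 'rV[C]_n -> 'rV[C]_m.+1) (s : seq R) :
  (forall O, open O -> O !=set0 -> O `<=` U -> exists2 x, O x & w x != 0) ->
  exists t, t \notin s /\ forall O, open O -> O !=set0 -> O `<=` U ->
    exists2 x, O x & pairing (w x) (moment m.+1 t) != 0.
Proof.
move=> hw.
pose Bad b := [set t : R | (exists2 x, rat_ball b x & w x != 0) /\
  (forall x, rat_ball b x -> pairing (w x) (moment m.+1 t) = 0)].
have fin b : finite_set (Bad b).
  have [[x bx wx]|hx] := pselect (exists2 x, rat_ball b x & w x != 0).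
    by apply: sub_finite_set (finite_moment_zeros wx) => t [_]; exact.
  by rewrite (_ : Bad b = set0) //; apply/seteqP; split => t // [].
have [t [ts ht]] := avoid_countable s fin; exists t; split => // O oO neO OU.
apply: contrapT => hn.
have z x : O x -> pairing (w x) (moment m.+1 t) = 0.
  by move=> Ox; apply/eqP; apply/negPn/negP => h; apply: hn; exists x.
have [x Ox wx] := hw O oO neO OU.
have [b [bx bO]] := rat_ball_basis oO Ox.
by apply: (ht b); split; [exists x|move=> y /bO /z].
Qed.

(** Let S be a sheet of common zeros on which c is not identically zero.  By
    [sheet_zeros] a rational ball meets {f = 0} inside S at a point where c is
    nonzero.  The points of {f = 0} in that ball do not depend on t, so the ball is
    bad for finitely many t. *)
Lemma generic_sheet m n (U : set 'rV[C]_n.+1) (f : 'rV[C]_n.+1 -> C)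
    (c : 'rV[C]_n.+1 -> 'rV[C]_m.+1) (s : seq R) :
  open U -> (forall x, U x -> differentiable f x) ->
  (forall O, open O -> O !=set0 -> O `<=` U -> exists2 x, O x & f x != 0) ->
  (forall x i, U x -> {for x, continuous (fun y => c y 0 i)}) ->
  exists t, t \notin s /\ forall S, sheet S -> S `<=` U ->
    (forall x, S x -> f x = 0 /\ pairing (c x) (moment m.+1 t) = 0) ->
    forall x, S x -> c x = 0.
Proof.
move=> oU df hf cc.
pose Bad b := [set t : R | (exists x, [/\ rat_ball b x, f x = 0 & c x != 0]) /\
  (forall x, rat_ball b x -> f x = 0 -> pairing (c x) (moment m.+1 t) = 0)].
have fin b : finite_set (Bad b).
  have [[x [bx fx cx]]|hx] := pselect (exists x, [/\ rat_ball b x, f x = 0 & c x != 0]).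
    by apply: sub_finite_set (finite_moment_zeros cx) => t [_ h]; exact: h.
  by rewrite (_ : Bad b = set0) //; apply/seteqP; split => t // [].
have [t [ts ht]] := avoid_countable s fin; exists t; split => // S hS SU hSf x Sx.
apply/eqP; apply/negPn/negP => /eqP cx0.
have [i ci] : exists i, c x 0 i != 0.
  apply: contrapT => hn; apply: cx0; apply/rowP => i; rewrite mxE.
  by apply/eqP; apply/negPn/negP => h; apply: hn; exists i.
(* On O1 the function c has no zeros; the sheet is shrunk to it beforehand so
   that every point found below is a witness against c = 0. *)
pose O1 := U `&` (fun y => c y 0 i) @^-1` [set z | z != 0].
have oO1 : open O1.
  rewrite openE => y [Uy cy]; apply: filterI; first exact: open_nbhs_nbhs.
  exact: (@cvgr_neq0 C C^o _ (nbhs y) (nbhs_filter y) (fun y => c y 0 i) _ (cc y i Uy) cy).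
have S1 : sheet (S `&` O1).
  by apply: sheet_restrict => //; exists x; split => //; split => //; exact: SU.
have S1U : S `&` O1 `<=` U by move=> y [/SU].
have S1f y : (S `&` O1) y -> f y = 0 by move=> [/hSf[]].
have [[D [oD DU [y [_ Dy]] h]]|[D [oD DU [y [[Sy O1y] Dy]] h]]] :=
  sheet_zeros S1 oU S1U df S1f.
  have [z Dz] := hf D oD (ex_intro _ y Dy) DU.
  by rewrite h // eqxx.
have [b [by' bD]] := rat_ball_basis oD Dy.
apply: (ht b); split.
  exists y; split => //; first exact: (hSf y Sy).1.
  by apply: contra (O1y.2) => /eqP ->; rewrite mxE.
by move=> z /bD Dz fz; have [Sz _] := h z Dz fz; exact: (hSf z Sz).2.
Qed.

End Genericity.

(** * The vector field *)

Section Construction.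
Variable R : realType.
Local Notation C := (Cplx R).

Lemma open_move n (O : set 'rV[C]_n) x v : open O -> O x ->
  exists2 e : C, e != 0 & O (x + e *: v).
Proof.
move=> oO Ox; have /nbhs_realdist[rho rho0 hrho] : nbhs x O by exact: open_nbhs_nbhs.
have [m m0 vm] := nonneg_realC (normr_ge0 v).
pose e := rho / (2 * (m + 1)).
have m1 : 0 < 2 * (m + 1) by rewrite mulr_gt0 // ltr_wpDl.
have e0 : 0 < e by rewrite divr_gt0.
exists (e%:C%C); first by rewrite -normr_gt0 normCR realC_gt0 normr_gt0 gt_eqF.
apply: hrho; rewrite addrAC subrr add0r normrZ normCR gtr0_norm // vm.
rewrite -(rmorphM (real_complex R)) ltcR /e mulrAC ltr_pdivrMr //.
by rewrite ltr_pM2l //; lra.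
Qed.

(** Take p so close to 0 that z p lies in U for |z| <= 18, with f(p) nonzero.  The
    function f(z p) of z is nonzero at z = 1, which is less than 9/8, so by
    [slice_zeros] on the square of half-side 9 it has no zeros close to 0 other
    than possibly 0.  The condition on the first coordinate of p allows the line to
    be straightened by a shear. *)
Lemma generic_line n (U : set 'rV[C]_n.+1) (f : 'rV[C]_n.+1 -> C) :
  open U -> U 0 -> (forall x, U x -> differentiable f x) ->
  (forall O, open O -> O !=set0 -> O `<=` U -> exists2 x, O x & f x != 0) ->
  exists2 p : 'rV[C]_n.+1, p 0 0 != 0 & forall e : R, 0 < e -> exists z : C,
    [/\ `|z *: p| < e%:C%C, U (z *: p) & f (z *: p) != 0].
Proof.
move=> oU U0 df hf.
have /nbhs_realdist[rho rho0 hrho] : nbhs (0 : 'rV[C]_n.+1) U by exact: open_nbhs_nbhs.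
(* 19 exceeds 18, a bound for |z| on the square of half-side 9. *)
pose O := ball (0 : 'rV[C]_n.+1) (rho / 19)%:C%C `&` (fun p => p 0 0) @^-1` [set z : C | z != 0].
have OE p : O p <-> `|p| < (rho / 19)%:C%C /\ p 0 0 != 0.
  by rewrite /O /= -ball_normE /ball_ /= sub0r normrN.
have oO : open O.
  apply: openI; first by apply: ball_open; rewrite realC_gt0 divr_gt0.
  rewrite openE => p pc.
  exact: (@cvgr_neq0 C C^o _ (nbhs p) (nbhs_filter p) (fun y : 'rV[C]_n.+1 => y 0 0) _ (@coord_continuous _ _ _ 0 0 p) pc).
have OU : O `<=` U.
  move=> p /OE[h _]; apply: hrho; rewrite subr0; apply: lt_trans h _.
  by rewrite ltcR ltr_pdivrMr // ltr_pMr // ltr1n.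
have neO : O !=set0.
  have r19 : (0 : C) < (rho / 19)%:C%C by rewrite realC_gt0 divr_gt0.
  have oB : open (ball (0 : 'rV[C]_n.+1) (rho / 19)%:C%C) by exact: ball_open.
  have B0 : ball (0 : 'rV[C]_n.+1) (rho / 19)%:C%C 0 by exact: ballxx.
  have [e e0 he] := open_move (delta_mx 0 0) oB B0.
  exists (e *: delta_mx 0 0); split; first by rewrite add0r in he.
  by rewrite /= !mxE !eqxx mulr1.
have [p Op fp] := hf O oO neO OU; have [pr p0] := (OE p).1 Op.
exists p => // e e0.
have inU (z : C) : `|z| <= 18%:R -> U (z *: p).
  move=> hz; apply: hrho; rewrite subr0 normrZ.
  apply: le_lt_trans (_ : _ <= (18 * (rho / 19))%:C%C) _; last by rewrite ltcR; lra.
  rewrite (rmorphM (real_complex R)) rmorph_nat; apply: ler_pM => //; exact: ltW.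
pose F (z : C) := f (z *: p).
have dF z : `|z| <= 18%:R -> differentiable F z.
  move=> hz; apply: (@differentiable_comp C C^o _ C^o (fun z : C => z *: p) f).
    by apply: (@differentiableZl C C^o _ (fun z : C => z) p); exact: ex_diff.
  by apply: df; exact: inU.
pose N := ball (0 : C) (9 / 8)%:C%C.
have NE z : N z <-> `|z| < (9 / 8 : R)%:C%C.
  by rewrite /N -ball_normE /ball_ /= sub0r normrN.
have oN : open N by apply: ball_open; rewrite realC_gt0 divr_gt0.
have := @slice_zeros R C^o F 1 id N 9.
case.
- by [].
- by move=> z; exact: cvg_id.
- by move=> v z; rewrite /= [z *: 1]mulr1.
- exact: oN.
- by move=> y _; rewrite [y *: 1]mulr1 subrr; apply/NE; rewrite normr0 realC_gt0 divr_gt0.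
- by move=> y /NE.
- move=> y s t Ny hs ht; rewrite [_ *: 1]mulr1 addrC subrK; apply: dF.
  apply: le_trans (normC_le_ReIm _) _; rewrite -(rmorph_nat (real_complex R)) lecR /=.
  have num (a b : R) : a <= 9 -> b <= 9 -> a + b <= 18 by lra.
  by apply: num; rewrite ler_norml.
- move=> /(_ 1) h; have : F 1 = 0.
    by apply: h; apply/NE; rewrite normr1 -(rmorph1 (real_complex R)) ltcR; lra.
  by rewrite /F scale1r => /eqP; rewrite (negbTE fp).
move=> [y1 [_ -> /nbhs_realdist[d d0 hd]]].
have [m m0 pm] := nonneg_realC (normr_ge0 p).
pose t := Num.min (d / 2) (Num.min (e / (2 * (m + 1))) 1).
have m1 : 0 < 2 * (m + 1) by rewrite mulr_gt0 // ltr_wpDl.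
have t0 : 0 < t by rewrite !lt_min !divr_gt0 //= ltr01.
have td : t < d by apply: le_lt_trans (_ : _ <= d / 2) _; rewrite ?ge_min ?lexx //; lra.
have te : t <= e / (2 * (m + 1)) by rewrite /t !ge_min lexx !orbT.
have t1 : t <= 1 by rewrite /t !ge_min lexx !orbT.
have tn : `|t%:C%C : C| = t%:C%C by rewrite normCR gtr0_norm.
exists (t%:C%C); split.
- rewrite normrZ tn pm -(rmorphM (real_complex R)) ltcR.
  apply: le_lt_trans (ler_wpM2r m0 te) _; rewrite mulrAC ltr_pdivrMr //.
  by rewrite ltr_pM2l //; lra.
- by apply: inU; rewrite tn -(rmorph_nat (real_complex R)) lecR; apply: le_trans t1 _; rewrite ler1n.
- apply/negP => /eqP Ft; have := hd (t%:C%C); rewrite subr0 tn ltcR => /(_ td Ft) /eqP.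
  by rewrite -normr_eq0 tn => /eqP -[] /eqP; rewrite gt_eqF.
Qed.

(** A sheet in the common zeros would by [sheet_zeros] fill {l1 = 0} near one of its
    points, but moving along v2 stays in {l1 = 0} and leaves {l2 = 0}. *)
Lemma codim2_no_sheet n (l1 l2 : 'rV[C]_n.+1 -> C) (v1 v2 : 'rV[C]_n.+1) :
  (forall x, differentiable l1 x) ->
  (forall x z, l1 (x + z *: v1) = l1 x + z) ->
  (forall x z, l1 (x + z *: v2) = l1 x) -> (forall x z, l2 (x + z *: v2) = l2 x + z) ->
  forall S, sheet S -> ~ (forall x, S x -> l1 x = 0 /\ l2 x = 0).
Proof.
move=> dl l11 l12 l22 S hS h.
have hS1 x : S x -> l1 x = 0 by move=> /h[].
have [[D [oD _ [y [_ Dy]] hD]]|[D [oD _ [y [Sy Dy]] hD]]] :=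
  sheet_zeros hS openT (@subsetT _ S) (fun x _ => dl x) hS1.
  have [e /eqP e0 De] := open_move v1 oD Dy.
  by apply: e0; have := hD _ De; rewrite l11 hD // add0r.
have [e /eqP e0 De] := open_move v2 oD Dy.
have [_] := h _ (hD _ De (etrans (l12 _ _) (hS1 y Sy))).
by rewrite l22 (h y Sy).2 add0r.
Qed.

(** A Vandermonde argument on the first three coordinates. *)
Lemma moment_independent m (t1 t2 t3 : R) (al be ga : C) : t1 != t2 -> t1 != t3 ->
  t2 != t3 ->
  al *: moment m.+3 t2 + be *: moment m.+3 t3 = ga *: moment m.+3 t1 ->
  al = 0 /\ be = 0.
Proof.
move=> n12 n13 n23 e.
have coef (i : 'I_m.+3) : al * t2%:C%C ^+ i + be * t3%:C%C ^+ i = ga * t1%:C%C ^+ i.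
  by have := congr1 (fun v : 'rV[C]_m.+3 => v 0 i) e; rewrite !mxE.
have c0 := coef (inord 0); have c1 := coef (inord 1); have c2 := coef (inord 2).
rewrite !inordK // ?expr0 ?expr1 ?mulr1 in c0 c1 c2.
have neq (s t : R) : s != t -> s%:C%C - t%:C%C != 0 :> C.
  by move=> st; rewrite subr_eq0; apply: contra st => /eqP -[->].
set a := t1%:C%C in c1 c2 *; set b := t2%:C%C in c1 c2 *; set c := t3%:C%C in c1 c2 *.
have n1 : a - b != 0 by exact: neq.
have n2 : a - c != 0 by exact: neq.
have n3 : b - c != 0 by exact: neq.
(* The second-degree polynomial with roots a and b kills all terms but be. *)
have eb : be * ((a - c) * (b - c)) = 0.
  have -> : be * ((a - c) * (b - c)) =
    (al * b ^+ 2 + be * c ^+ 2) - (a + b) * (al * b + be * c) + a * b * (al + be) by ring.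
  by rewrite c0 c1 c2; ring.
have b0 : be = 0.
  by move/eqP: eb; rewrite !mulf_eq0 (negbTE n2) (negbTE n3) !orbF => /eqP.
split => //.
have ea : al * (a - b) = 0.
  have -> : al * (a - b) = a * (al + be) - (al * b + be * c) by rewrite b0; ring.
  by rewrite c0 c1; ring.
by move/eqP: ea; rewrite mulf_eq0 (negbTE n1) orbF => /eqP.
Qed.

Lemma sheet_restrict_neq0 n (U S : set 'rV[C]_n.+1) (f : 'rV[C]_n.+1 -> C) x :
  open U -> (forall y, U y -> differentiable f y) -> sheet S -> S `<=` U ->
  S x -> f x != 0 ->
  exists S', [/\ sheet S', S' `<=` S & forall y, S' y -> f y != 0].
Proof.
move=> oU df hS SU Sx fx.
pose D := U `&` f @^-1` [set z | z != 0].
have oD : open D.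
  rewrite openE => y [Uy fy]; apply: filterI; first exact: open_nbhs_nbhs.
  exact: (@cvgr_neq0 C C^o _ (nbhs y) (nbhs_filter y) f _ (differentiable_continuous (df y Uy)) fy).
exists (S `&` D); split; last by move=> y [_ []].
  by apply: sheet_restrict => //; exists x; split => //; split => //; exact: SU.
by move=> y [].
Qed.

Lemma differentiable_pairing n m (U : set 'rV[C]_n) (w : 'rV[C]_n -> 'rV[C]_m) (a : 'rV[C]_m) x :
  holomorphic_on U w -> U x -> differentiable (fun y => pairing (w y) a) x.
Proof.
move=> hw Ux.
rewrite (_ : (fun y => _) = \sum_(i < m) (fun y => w y 0 i * a 0 i)); last first.
  by apply/funext => y; rewrite fct_sumE.
apply: (@differentiable_sum C _ C^o) => i.
apply: (@differentiableM C _ (fun y => w y 0 i) (cst (a 0 i))); last exact: differentiable_cst.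
apply: (@differentiable_comp C _ _ _ w (fun v : 'rV[C]_m => v 0 i)); first exact: hw.
exact: differentiable_coord.
Qed.

(** Restrict S first to where a coefficient of w is nonzero, so that l2 = 0 there, and
    then to where g is nonzero, so that l1 = 0 as well. *)
Lemma no_common_sheet n (U : set 'rV[C]_n.+1) (w : 'rV[C]_n.+1 -> 'rV[C]_n.+1)
    (f g l1 l2 : 'rV[C]_n.+1 -> C) : open U -> holomorphic_on U w ->
  (forall x, U x -> differentiable g x) ->
  (forall S, sheet S -> ~ (S `<=` sing w `&` U)) ->
  (forall S, sheet S -> S `<=` U -> ~ (forall x, S x -> f x = 0 /\ g x = 0)) ->
  (forall S, sheet S -> ~ (forall x, S x -> l1 x = 0 /\ l2 x = 0)) ->
  forall S, sheet S -> S `<=` U ->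
    ~ (forall x, S x -> [/\ f x = 0, l1 x * g x = 0 & forall j, l2 x * w x 0 j = 0]).
Proof.
move=> oU holw dg noW nofg noL S hS SU hz.
have [x [j [Sx wx]]] : exists x j, S x /\ w x 0 j != 0.
  apply: contrapT => hn; apply: (noW S hS) => x Sx; split; last exact: SU.
  apply/rowP => j; rewrite mxE; apply/eqP; apply/negPn/negP => wx.
  by apply: hn; exists x, j.
have dwj y : U y -> differentiable (fun y => w y 0 j) y.
  move=> Uy; apply: (@differentiable_comp C _ _ _ w (fun v : 'rV[C]_n.+1 => v 0 j)).
    exact: holw.
  exact: differentiable_coord.
have [S1 [hS1 S1S w1]] := sheet_restrict_neq0 oU dwj hS SU Sx wx.
have l20 y : S1 y -> l2 y = 0.
  move=> S1y; have [_ _ /(_ j)/eqP] := hz y (S1S _ S1y).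
  by rewrite mulf_eq0 (negbTE (w1 _ S1y)) orbF => /eqP.
have S1U y : S1 y -> U y by move=> /S1S /SU.
have [y [S1y gy]] : exists y, S1 y /\ g y != 0.
  apply: contrapT => hn; apply: (nofg S1 hS1 S1U) => y S1y.
  split; first by have [] := hz y (S1S _ S1y).
  by apply/eqP; apply/negPn/negP => gy; apply: hn; exists y.
have [S2 [hS2 S2S g2]] := sheet_restrict_neq0 oU dg hS1 S1U S1y gy.
apply: (noL S2 hS2) => z S2z; split; last by apply: l20; exact: S2S.
have [_ /eqP + _] := hz z (S1S _ (S2S _ S2z)).
by rewrite mulf_eq0 (negbTE (g2 _ S2z)) orbF => /eqP.
Qed.

(** The vectors a, b, d and the line are chosen one after the other, each time
    outside a countable set of bad parameters for the previous choices. *)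
Lemma flag_from_foliation m (w : 'rV[C]_m.+3 -> 'rV[C]_m.+3) : codim1_foliation w ->
  exists X : 'rV[C]_m.+3 -> 'rV[C]_m.+3,
    [/\ dim1_foliation X, has_codim_at (sing X) 0 2, flag2 X w &
        \forall x \near (0 : 'rV[C]_m.+3), sing w x -> sing X x].
Proof.
move=> hw; have [U [oU U0 holw _ redw]] := hw.
have noW := reduced_no_sheet oU holw redw.
have hopen (O : set 'rV[C]_m.+3) : open O -> O !=set0 -> O `<=` U -> exists2 x, O x & w x != 0.
  move=> oO neO OU; apply: contrapT => hn.
  have [S hS SO] := open_has_sheet oO neO; apply: (noW S hS) => x /SO Ox.
  split; last exact: OU.
  by apply/eqP; apply/negPn/negP => h; apply: hn; exists x.
have [t1 [_ h1]] := generic_no_open_zero (Nil R) hopen.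
pose a : 'rV[C]_m.+3 := moment m.+3 t1; pose f x := pairing (w x) a.
have df x : U x -> differentiable f x by exact: differentiable_pairing.
have cw x (i : 'I_m.+3) : U x -> {for x, continuous (fun y => w y 0 i)}.
  move=> Ux; apply: (@continuous_comp _ _ _ w (fun v : 'rV[C]_m.+3 => v 0 i)).
    exact: holomorphic_continuous holw Ux.
  exact: coord_continuous.
have [t2 [t21 h2]] := generic_sheet [:: t1] oU df h1 cw.
pose b : 'rV[C]_m.+3 := moment m.+3 t2; pose g x := pairing (w x) b.
have dg x : U x -> differentiable g x by exact: differentiable_pairing.
have nofg S : sheet S -> S `<=` U -> ~ (forall x, S x -> f x = 0 /\ g x = 0).
  move=> hS SU hfg; apply: (noW S hS) => x Sx; split; last exact: SU.
  exact: (h2 S hS SU hfg).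
have [p p0 hp] := generic_line oU U0 df h1.
(* The shear phi sends the line through p into {last two coordinates = 0}; these
   coordinates of phi are the linear forms l1 and l2.  As m.+3 >= 3, the first
   coordinate is not one of them and phi leaves it unchanged. *)
pose k : 'rV[C]_m.+3 := \row_i (if (m.+1 <= i)%N then p 0 i / p 0 0 else 0).
pose i1 : 'I_m.+3 := inord m.+1; pose i2 : 'I_m.+3 := ord_max.
have vi1 : i1 = m.+1 :> nat by rewrite inordK.
pose phi (x : 'rV[C]_m.+3) : 'rV[C]_m.+3 := x + x 0 0 *: - k.
pose psi (x : 'rV[C]_m.+3) : 'rV[C]_m.+3 := x + x 0 0 *: k.
pose l1 x := phi x 0 i1; pose l2 x := phi x 0 i2.
have dshear (q x : 'rV[C]_m.+3) : differentiable (fun x : 'rV[C]_m.+3 => x + x 0 0 *: q) x.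
  apply: (@differentiableD C _ _ id (fun x : 'rV[C]_m.+3 => x 0 0 *: q)); first exact: ex_diff.
  by apply: (@differentiableZl C _ _ (fun x : 'rV[C]_m.+3 => x 0 0) q); exact: differentiable_coord.
have dphi i x : differentiable (fun x => phi x 0 i) x.
  apply: (@differentiable_comp C _ _ _ phi (fun v : 'rV[C]_m.+3 => v 0 i)); first exact: dshear.
  exact: differentiable_coord.
have phiK x : psi (phi x) = x.
  by apply/rowP => i; rewrite /psi /phi !mxE; ring.
have psiK x : phi (psi x) = x.
  by apply/rowP => i; rewrite /psi /phi !mxE; ring.
have phi_delta x z (i j : 'I_m.+3) : j != 0 ->
    phi (x + z *: delta_mx 0 j) 0 i = phi x 0 i + z * (i == j)%:R.
  by move=> j0; rewrite /phi !mxE !eqxx [0 == j]eq_sym (negbTE j0) /=; ring.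
have i10 : i1 != 0 by rewrite -val_eqE /= vi1.
have i20 : i2 != 0 by rewrite -val_eqE.
have i12 : i1 == i2 = false by rewrite -val_eqE /= vi1 ltn_eqF.
have noL S : sheet S -> ~ (forall x, S x -> l1 x = 0 /\ l2 x = 0).
  apply: (codim2_no_sheet (v1 := delta_mx 0 i1) (v2 := delta_mx 0 i2)).
  - exact: dphi.
  - by move=> x z; rewrite /l1 phi_delta // eqxx mulr1.
  - by move=> x z; rewrite /l1 phi_delta // i12 mulr0 addr0.
  - by move=> x z; rewrite /l2 phi_delta // eqxx mulr1.
(* Arranged so that pairing with the moment vector of t gives l1 g + t l2 h, with
   h the value of w at that moment vector: t is both the coefficient r and the
   parameter of d. *)
pose c (x : 'rV[C]_m.+3) : 'rV[C]_m.+4 :=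
  \row_i (if unlift 0 i is Some j then l2 x * w x 0 j else l1 x * g x).
have cc x i : U x -> {for x, continuous (fun y => c y 0 i)}.
  move=> Ux; rewrite (_ : (fun y => c y 0 i) = (fun y => if unlift 0 i is Some j then l2 y * w y 0 j else l1 y * g y)); last first.
    by apply/funext => y; rewrite mxE.
  case: unlift => [j|].
    apply: (@continuousM_C R _ x l2 (fun y => w y 0 j)); last exact: cw.
    by apply: differentiable_continuous; exact: dphi.
  apply: (@continuousM_C R _ x l1 g); apply: differentiable_continuous; first exact: dphi.
  exact: dg.
(* t3 must differ from t1 and t2 for independence, and from 0 as a coefficient. *)
have [t3 [t3n h3]] := generic_sheet [:: t1; t2; 0] oU df h1 cc.
pose d : 'rV[C]_m.+3 := moment m.+3 t3; pose h x := pairing (w x) d.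
have cE x : pairing (c x) (moment m.+4 t3) = l1 x * g x + t3%:C%C * l2 x * h x.
  rewrite /pairing big_ord_recl !mxE unlift_none expr0 mulr1; congr (_ + _).
  rewrite /h /pairing mulr_sumr; apply: eq_bigr => i _.
  by rewrite !mxE liftK (lift0 i) exprS; ring.
pose ga x := l1 x * g x + t3%:C%C * l2 x * h x.
pose X x : 'rV[C]_m.+3 :=
  (f x * l1 x) *: b + (f x * (t3%:C%C * l2 x)) *: d - ga x *: a.
have Xw x : pairing (w x) (X x) = 0.
  have -> : pairing (w x) (X x) = f x * l1 x * g x + f x * (t3%:C%C * l2 x) * h x - ga x * f x.
    rewrite /g /h [X in _ - _ * X]/f /pairing !mulr_sumr -big_split -sumrB /=.
    by apply: eq_bigr => i _; rewrite !mxE; ring.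
  by rewrite /ga; ring.
have [n12 [n13 n23 n30]] : t1 != t2 /\ [/\ t1 != t3, t2 != t3 & t3 != 0].
  by move: t21 t3n; rewrite !inE !negb_or eq_sym => -> /and3P[? ? ?]; rewrite ![_ == t3]eq_sym.
have t30 : t3%:C%C != 0 :> C by apply: contra n30 => /eqP -[->].
have X0 x : l1 x = 0 -> l2 x = 0 -> X x = 0.
  by move=> e1 e2; rewrite /X /ga e1 e2 !(mulr0, mul0r, addr0) !scale0r !addr0 subr0.
have singX x : X x = 0 -> (l1 x = 0 /\ l2 x = 0) \/ (f x = 0 /\ ga x = 0).
  move=> Xx; have /(moment_independent n12 n13 n23)[/eqP e1 /eqP e2] :
      (f x * l1 x) *: moment m.+3 t2 + (f x * (t3%:C%C * l2 x)) *: moment m.+3 t3 =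
      ga x *: moment m.+3 t1 by apply/eqP; rewrite -subr_eq0; apply/eqP.
  have [fx|fx] := eqVneq (f x) 0; last first.
    left; move: e1 e2; rewrite !mulf_eq0 (negbTE fx) (negbTE t30) /=.
    by move=> /eqP ? /eqP.
  right; split => //; have := congr1 (fun v : 'rV[C]_m.+3 => v 0 0) Xx.
  by rewrite /X fx !mul0r !scale0r add0r sub0r !mxE expr0 mulr1 => /eqP; rewrite oppr_eq0 => /eqP.
have noX S : sheet S -> ~ (S `<=` sing X `&` U).
  move=> hS SX; have SU : S `<=` U by move=> x /SX[].
  have key S' : sheet S' -> S' `<=` S -> ~ (forall x, S' x -> f x = 0 /\ pairing (c x) (moment m.+4 t3) = 0).
    move=> hS' S'S hz; have S'U x : S' x -> U x by move=> /S'S /SU.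
    have c0 := h3 S' hS' S'U hz.
    apply: (no_common_sheet oU holw dg noW nofg noL hS' S'U) => x S'x.
    split; first exact: (hz x S'x).1.
      have := congr1 (fun v : 'rV[C]_m.+4 => v 0 0) (c0 x S'x).
      by rewrite !mxE unlift_none.
    move=> j; have := congr1 (fun v : 'rV[C]_m.+4 => v 0 (lift 0 j)) (c0 x S'x).
    by rewrite !mxE liftK.
  (* A sheet of zeros of X not contained in {l = 0} would lie in the second part
     of the zero set, after shrinking. *)
  have split_l (l : 'rV[C]_m.+3 -> C) x : (forall y, U y -> differentiable l y) ->
      (forall y, l1 y = 0 /\ l2 y = 0 -> l y = 0) -> S x -> l x = 0.
    move=> dl hl Sx; apply/eqP; apply/negPn/negP => lx.
    have [S1 [hS1 S1S nl]] := sheet_restrict_neq0 oU dl hS SU Sx lx.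
    apply: (key S1 hS1 S1S) => y S1y; have [Xy _] := SX _ (S1S _ S1y).
    by rewrite cE; have [/hl|//] := singX y Xy; move/eqP; rewrite (negbTE (nl y S1y)).
  apply: (noL S hS) => x Sx; split.
    by apply: (split_l l1) => // [y _|y []]; first exact: dphi.
  by apply: (split_l l2) => // [y _|y []]; first exact: dphi.
have dh x : U x -> differentiable h x by exact: differentiable_pairing.
have holX : holomorphic_on U X.
  move=> x Ux; have dt (u : C) : differentiable (cst u : 'rV[C]_m.+3 -> C) x by exact: differentiable_cst.
  have dl1 : differentiable l1 x by exact: dphi.
  have dl2 : differentiable l2 x by exact: dphi.
  have dtl2 := differentiableM (dt t3%:C%C) dl2.
  have d1 := differentiableZl b (differentiableM (df x Ux) dl1).
  have d2 := differentiableZl d (differentiableM (df x Ux) dtl2).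
  have d3 := differentiableZl a (differentiableD (differentiableM dl1 (dg x Ux))
    (differentiableM dtl2 (dh x Ux))).
  exact: (differentiableB (differentiableD d1 d2) d3).
have folX : dim1_foliation X.
  by exists U; split => //; exact: no_sheet_reduced.
have nU : nbhs (0 : 'rV[C]_m.+3) U by exact: open_nbhs_nbhs.
have Xsing x : w x = 0 -> X x = 0.
  move=> wx; have z (v : 'rV[C]_m.+3) : pairing (w x) v = 0.
    by rewrite /pairing wx big1 // => i _; rewrite mxE mul0r.
  by rewrite /X /ga /f /g /h !z !(mulr0, mul0r, addr0) !scale0r !addr0 subr0.
have phiP x : l1 x = 0 /\ l2 x = 0 <-> forall i : 'I_m.+3, (m.+1 <= i)%N -> phi x 0 i = 0.
  split=> [[e1 e2] i|hi]; last first.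
    by split; apply: hi; rewrite ?vi1 //= ltnW.
  have := ltn_ord i; rewrite ltnS leq_eqVlt => /orP[/eqP e _|lt1 lt2].
    by rewrite (_ : i = i2) //; apply/val_inj.
  rewrite (_ : i = i1) //; apply/val_inj; rewrite /= vi1.
  by apply/eqP; rewrite eqn_leq lt2 -ltnS lt1.
exists X; split => //.
- exists m.+1; split; first by rewrite addn2.
    move=> D /nbhs_realdist[e e0 hD]; have [z [ze Uz fz]] := hp e e0.
    exists (z *: p); split; last by apply: hD; rewrite subr0.
    have [lz1 lz2] : l1 (z *: p) = 0 /\ l2 (z *: p) = 0.
      apply/phiP => i mi; rewrite /phi !mxE mi.
      by field.
    apply/regular_pointE; split; [exact: X0|by rewrite ltnW|].
    pose V := U `&` f @^-1` [set u | u != 0].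
    have oV : open V.
      rewrite openE => y [Uy fy]; apply: filterI; first exact: open_nbhs_nbhs.
      exact: (@cvgr_neq0 C C^o _ (nbhs y) (nbhs_filter y) f _ (differentiable_continuous (df y Uy)) fy).
    exists V, (psi @^-1` V), phi, psi; split; [split| by split|].
    + split => //; apply: open_comp => // y _; apply: differentiable_continuous; exact: dshear.
    + split; [by move=> x _; exact: dshear|by move=> x _; exact: dshear| |by []].
      by move=> x Vx; rewrite /preimage /= phiK.
    + by move=> x _; exact: phiK.
    + by move=> x _; exact: psiK.
    move=> x [Ux /= fx]; split.
      by move=> /singX[/phiP//|[fx0]]; move: fx; rewrite fx0 eqxx.
    by move=> /phiP[]; exact: X0.
  move: nU; apply: filterS => q Uq e rq; rewrite leqNgt; apply/negP => me.
  have [S [hS Sq SX]] := regular_point_has_sheet rq me.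
  apply: (noX (S `&` U)); last by move=> x [/SX ? ?]; split.
  by apply: sheet_restrict => //; exists q.
- by split => //; move: nU; apply: filterS => x _; exact: Xw.
- by move: nU; apply: filterS => x _; exact: Xsing.
Qed.

End Construction.

Theorem corollary1p4 (R : realType) (n : nat) (hn : (3 <= n)%N)
    (w : 'rV[Cplx R]_n -> 'rV[Cplx R]_n) (hw : codim1_foliation w) :
  exists X : 'rV[Cplx R]_n -> 'rV[Cplx R]_n,
    [/\ dim1_foliation X,
        has_codim_at (sing X) 0 2,
        flag2 X w &
        \forall x \near (0 : 'rV[Cplx R]_n), sing w x -> sing X x].
Proof.
by case: n hn w hw => [//|[//|[//|m]]] _ w; exact: flag_from_foliation.
Qed.
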